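(* Unless $\mathsf{NP} \subseteq \mathsf{coNP}/\mathsf{poly}$, the \textsc{Identifying Code} problem, parameterized by the solution size $k$, does not admit a polynomial kernel.
   Context: All graphs are finite and simple. For a graph $G=(V,E)$ and $v\in V$, $N[v]$ denotes the closed neighborhood of $v$ (i.e., $v$ together with its neighbors). An identifying code of $G$ is a set $I\subseteq V$ such that for every $v\in V$ the set $N[v]\cap I$ is nonempty, and for any two distinct vertices $u\neq v$ we have $N[u]\cap I\neq N[v]\cap I$. The \textsc{Identifying Code} problem: given a graph $G$ and an integer $k$, decide whether $G$ has an identifying code of size at most $k$. A polynomial kernel for a parameterized problem is a polynomial-time algorithm that maps any instance $(x,k)$ to an equivalent instance $(x',k')$ whose size (and $k'$) is bounded by a polynomial in the parameter $k$. *)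

(* Defs.v *)
From HB Require Import structures.
From mathcomp Require Import all_boot all_order all_algebra.

Set Implicit Arguments.
Unset Strict Implicit.
Unset Printing Implicit Defensive.

(** Deterministic multi-tape Turing machines.  A cell holds a blank ([None]),
    an input/output bit ([Some (inl b)]) or one of the machine's own work
    symbols ([Some (inr a)]). *)

Definition cell (A : finType) : finType := option (bool + A)%type.

Variant move := MoveLeft | Stay | MoveRight.

(** A two-way infinite tape as a zipper: [tleft] lists the cells to the left of
    the head, nearest first; all cells beyond the two lists are blank. *)
Record tape (A : finType) := Tape {
  tleft : seq (cell A);
  thead : cell A;
  tright : seq (cell A) }.

Definition tape_write (A : finType) (t : tape A) (c : cell A) : tape A :=
  Tape (tleft t) c (tright t).

Definition tape_move (A : finType) (t : tape A) (m : move) : tape A :=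
  match m with
  | MoveLeft =>
      Tape (behead (tleft t)) (head None (tleft t)) (thead t :: tright t)
  | Stay => t
  | MoveRight =>
      Tape (thead t :: tleft t) (head None (tright t)) (behead (tright t))
  end.

(** [tm_trans] is a map between finite types, hence always a finite table. *)
Record TM := MkTM {
  tm_tapes : nat; (* the machine has [tm_tapes.+1] tapes *)
  tm_work : finType;
  tm_state : finType;
  tm_start : tm_state;
  tm_halt : pred tm_state;
  tm_trans : tm_state -> {ffun 'I_tm_tapes.+1 -> cell tm_work} ->
             tm_state * ('I_tm_tapes.+1 -> cell tm_work * move) }.

Definition config (M : TM) : Type :=
  (tm_state M * {ffun 'I_(tm_tapes M).+1 -> tape (tm_work M)})%type.

Definition tm_step (M : TM) (c : config M) : config M :=
  if tm_halt c.1 then c else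
  let r := tm_trans c.1 [ffun i => thead (c.2 i)] in
  (r.1, [ffun i => tape_move (tape_write (c.2 i) (r.2 i).1) (r.2 i).2]).

Definition tape_of_bits (A : finType) (s : seq bool) : tape A :=
  let cs : seq (cell A) := [seq Some (inl b) | b <- s] in
  Tape [::] (head None cs) (behead cs).

(** Input on tape 0, head on its first bit; every other tape is blank. *)
Definition tm_init (M : TM) (s : seq bool) : config M :=
  (tm_start M,
   [ffun i => tape_of_bits (tm_work M) (if i == ord0 then s else [::])]).

Fixpoint leading_bits (A : finType) (cs : seq (cell A)) : seq bool :=
  if cs is Some (inl b) :: cs' then b :: leading_bits cs' else [::].

(** The output is the maximal block of bits that starts at the head of tape 0
    and extends to the right. *)
Definition tm_output (M : TM) (c : config M) : seq bool :=
  leading_bits (thead (c.2 ord0) :: tright (c.2 ord0)).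

(** Halted configurations are fixed by [tm_step], so this says that [M] halts
    on [s] after at most [t] steps with output [s']. *)
Definition tm_computes_in (M : TM) (s : seq bool) (t : nat) (s' : seq bool) :
    Prop :=
  let c := iter t (@tm_step M) (tm_init M s) in
  tm_halt c.1 /\ tm_output c = s'.

(** Polynomial-time computability of [f] with respect to binary encodings of
    its arguments and values; time is measured in the length of the encoded
    argument. *)
Definition polytime (X Y : Type) (encX : X -> seq bool) (encY : Y -> seq bool)
    (f : X -> Y) : Prop :=
  exists (M : TM) (p : {poly nat}), forall x : X,
    tm_computes_in M (encX x) (p.[size (encX x)])%R (encY (f x)).

Definition language := seq bool -> Prop.

Definition complexity_class := language -> Prop.

(** Self-delimiting pairing: each bit of [x] is preceded by a 1, and a 0 marks
    the end of [x]. *)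
Definition pair_code (x y : seq bool) : seq bool :=
  flatten [seq [:: true; b] | b <- x] ++ false :: y.

Definition class_P : complexity_class := fun L =>
  exists f : seq bool -> bool,
    polytime id (fun b : bool => [:: b]) f /\ forall x, L x <-> f x.

Definition class_NP : complexity_class := fun L =>
  exists (V : language) (p : {poly nat}),
    class_P V /\
    forall x, L x <->
      exists y, size y <= (p.[size x])%R /\ V (pair_code x y).

Definition co_class (C : complexity_class) : complexity_class := fun L =>
  C (fun x => ~ L x).

(** The class C/poly: polynomial-length advice depending only on the length of
    the input. *)
Definition with_poly_advice (C : complexity_class) : complexity_class := fun L =>
  exists (L' : language) (a : nat -> seq bool) (p : {poly nat}),
    [/\ C L',
        forall n, size (a n) <= (p.[n])%R
      & forall x, L x <-> L' (pair_code x (a (size x)))].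

Definition class_coNP_poly : complexity_class :=
  with_poly_advice (co_class class_NP).

Definition class_subset (C D : complexity_class) : Prop :=
  forall L, C L -> D L.

Definition instance := (seq bool * nat)%type.

Definition param_problem := instance -> Prop.

(** The parameter is written in unary, so an instance [(x, k)] has encoded
    length [size x + k + 1]. *)
Definition instance_code (i : instance) : seq bool :=
  nseq i.2 true ++ false :: i.1.

Definition has_polynomial_kernel (Q : param_problem) : Prop :=
  exists (K : instance -> instance) (p : {poly nat}),
    [/\ polytime instance_code instance_code K,
        forall i, Q i <-> Q (K i)
      & forall i, size (K i).1 + (K i).2 <= (p.[i.2])%R].

Definition closed_nbhd (T : finType) (e : rel T) (v : T) : {set T} :=
  [set u | (u == v) || e v u].

Definition identifying_code (T : finType) (e : rel T) (I : {set T}) : Prop :=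
  (forall v, closed_nbhd e v :&: I <> set0) /\
  (forall u v, u <> v -> closed_nbhd e u :&: I <> closed_nbhd e v :&: I).

(** Row-major adjacency matrix, [n * n] bits. *)
Definition graph_code (n : nat) (e : rel 'I_n) : seq bool :=
  [seq e i j | i <- enum 'I_n, j <- enum 'I_n].

(** Strings that do not encode a simple graph are no-instances. *)
Definition IdentifyingCode : param_problem := fun i =>
  exists (n : nat) (e : rel 'I_n),
    [/\ symmetric e, irreflexive e, i.1 = graph_code e
      & exists I : {set 'I_n}, identifying_code e I /\ #|I| <= i.2].

(* Main.v *)
From HB Require Import structures.
From mathcomp Require Import all_boot all_order all_algebra.
From mathcomp Require Import boolp zify.
Require Import Defs.

Set Implicit Arguments.
Unset Strict Implicit.
Unset Printing Implicit Defensive.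

(** Suppose that Identifying Code has a polynomial kernel and let [L] be in NP.

    For a fixed length [n], the computation of a verifier for [L] is described by
    local constraints on the cells of its tableau.  Satisfying such constraints
    means choosing one value per variable so as to hit a family of sets, and a
    choice hitting all sets of a family becomes an identifying code: every set is
    turned into two adjacent twins whose closed neighbourhoods differ in exactly
    that set, while logarithmically many forced vertices tell all other vertices
    apart.  The question whether one of [t] given inputs is in [L] only requires
    one more choice, that of an index below [t], so its parameter is polynomial in
    [n] and [log t].

    With [t] larger than the size of the kernel, a counting argument in the style
    of Fortnow and Santhanam yields polynomially many kernels that are
    no-instances and such that each [x] of length [n] outside [L] is part of a
    [t]-tuple mapped to one of them.  These kernels, together with a straight-line
    program writing down the composed graph, form the advice; a certificate for
    [x] not in [L] consists of the remaining inputs of such a tuple. *)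

(** * Polynomial bounds *)

Definition poly_bounded (f : nat -> nat) : Prop :=
  exists p : {poly nat}, forall n, f n <= (p.[n])%R.

Lemma horner_nat_mono (p : {poly nat}) m n :
  m <= n -> ((p.[m])%R : nat) <= (p.[n])%R.
Proof.
move=> le_mn; elim/poly_ind: p => [|p c IH]; first by rewrite !horner0.
by rewrite !hornerMXaddC; apply: leq_add => //; apply: leq_mul.
Qed.

Lemma poly_bounded_le f g :
  (forall n, f n <= g n) -> poly_bounded g -> poly_bounded f.
Proof. by move=> le_fg [p gp]; exists p => n; apply: leq_trans (gp n). Qed.

Lemma poly_bounded_const c : poly_bounded (fun=> c).
Proof. by exists (c%:P)%R => n; rewrite hornerC. Qed.

Lemma poly_bounded_id : poly_bounded id.
Proof. by exists 'X%R => n; rewrite hornerX. Qed.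

Lemma poly_bounded_add f g :
  poly_bounded f -> poly_bounded g -> poly_bounded (fun n => f n + g n).
Proof.
by move=> [p fp] [q gq]; exists (p + q)%R => n; rewrite hornerD; apply: leq_add.
Qed.

Lemma poly_bounded_mul f g :
  poly_bounded f -> poly_bounded g -> poly_bounded (fun n => f n * g n).
Proof.
by move=> [p fp] [q gq]; exists (p * q)%R => n; rewrite hornerM; apply: leq_mul.
Qed.

Lemma poly_bounded_horner (p : {poly nat}) f :
  poly_bounded f -> poly_bounded (fun n => (p.[f n])%R).
Proof.
move=> [q fq]; exists (p \Po q)%R => n; rewrite horner_comp.
exact: horner_nat_mono.
Qed.

Lemma poly_bounded_succ f : poly_bounded f -> poly_bounded (fun n => (f n).+1).
Proof.
move=> fp; apply: (@poly_bounded_le _ (fun n => f n + 1)) => [n|].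
  by rewrite addn1.
by apply: poly_bounded_add => //; apply: poly_bounded_const.
Qed.

Lemma poly_bounded_double f : poly_bounded f -> poly_bounded (fun n => (f n).*2).
Proof.
move=> fp; apply: (@poly_bounded_le _ (fun n => f n + f n)) => [n|].
  by rewrite addnn.
exact: poly_bounded_add.
Qed.

Ltac poly_bound :=
  repeat first
    [ assumption
    | exact: poly_bounded_id
    | exact: poly_bounded_const
    | apply: poly_bounded_double
    | apply: poly_bounded_succ
    | apply: poly_bounded_add
    | apply: poly_bounded_mul
    | apply: poly_bounded_horner ].

Lemma exp_le_ffact m d : m ^ d <= (m + d) ^_ d.
Proof.
elim: d => [|d IH]; first by rewrite expn0 ffactn0.
by rewrite expnS addnS ffactSS leq_mul // ?leqW ?leq_addr.
Qed.

Lemma exp_le_exp2 d : exists C, forall m, m ^ d <= C * 2 ^ m.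
Proof.
exists (d`! * 2 ^ d) => m; apply: leq_trans (exp_le_ffact m d) _.
rewrite -bin_ffact mulnC -mulnA leq_mul2l -expnD addnC; apply/orP; right.
(* The binomial coefficient is a single term in the expansion of [(1 + 1) ^ (m + d)]. *)
rewrite -[2]/(1 + 1) expnDn (bigD1 (inord d)) //= inordK.
  by rewrite !exp1n !muln1 leq_addr.
by rewrite ltnS leq_addr.
Qed.

(** Needed to fix the parameters at the end: the number of composed inputs, polynomial in the
    address length, must stay below an exponential in it. *)
Lemma horner_le_exp2 (p : {poly nat}) :
  exists C, forall m, ((p.[m])%R : nat) <= C * 2 ^ m.
Proof.
rewrite -[p]coefK poly_def; elim/big_ind: _ => [|q r [C hC] [D hD]|i _].
- by exists 0 => m; rewrite horner0.
- by exists (C + D) => m; rewrite hornerD mulnDl leq_add.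
have [C hC] := exp_le_exp2 i; exists (p`_i * C)%R => m.
by rewrite hornerZ hornerXn -mulnA leq_mul.
Qed.

(** * Tapes in coordinates relative to the head *)

(** With the head always at coordinate 0, a head move becomes a shift of the whole tape. The new
    content of a coordinate then depends only on its neighbourhood, the state and the scanned
    symbols, and head positions need not be recorded. *)
Definition tget (A : finType) (t : tape A) (d : int) : cell A :=
  match d with
  | Posz 0 => thead t
  | Posz j.+1 => nth None (tright t) j
  | Negz j => nth None (tleft t) j
  end.

Definition shift (m : move) : int :=
  match m with MoveLeft => (-1)%R | Stay => 0%R | MoveRight => 1%R end.

Lemma tget_move (A : finType) (t : tape A) m d :
  tget (tape_move t m) d = tget t (d + shift m)%R.
Proof.
case: m.
- case: d => [[|[|d]]|d].
  + by rewrite -[RHS]/(nth None (tleft t) 0) nth0.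
  + by [].
  + by have -> : (Posz d.+2 + shift MoveLeft)%R = Posz d.+1 by rewrite /shift; lia.
  + have -> : (Negz d + shift MoveLeft)%R = Negz d.+1 by rewrite /shift; lia.
    by rewrite /= nth_behead.
- by rewrite GRing.addr0.
- case: d => [d|[|d]] //.
    have -> : (Posz d + shift MoveRight)%R = Posz d.+1 by rewrite /shift; lia.
    by case: d => [|d] /=; rewrite ?nth0 // nth_behead.
  by have -> : (Negz d.+1 + shift MoveRight)%R = Negz d by rewrite /shift; lia.
Qed.

Lemma tget_write (A : finType) (t : tape A) c d :
  tget (tape_write t c) d = if d == 0%R then c else tget t d.
Proof. by case: d => [[|d]|d]. Qed.

Lemma tget_step (A : finType) (t : tape A) c m d :
  tget (tape_move (tape_write t c) m) d =
  if (d + shift m == 0)%R then c else tget t (d + shift m)%R.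
Proof. by rewrite tget_move tget_write. Qed.

Lemma tget_tape_of_bits (A : finType) (s : seq bool) (o : nat) :
  tget (tape_of_bits A s) o = nth None [seq Some (inl b) | b <- s] o.
Proof. by case: o => [|o] /=; rewrite ?nth0 // nth_behead. Qed.

Lemma iter_tm_halted (M : TM) (c : config M) m :
  tm_halt c.1 -> iter m (@tm_step M) c = c.
Proof. by move=> hc; elim: m => //= m ->; rewrite /tm_step hc. Qed.

Lemma tm_computes_in_le (M : TM) s t t' s' :
  t <= t' -> tm_computes_in M s t s' -> tm_computes_in M s t' s'.
Proof.
rewrite /tm_computes_in => le_t [ht ot].
by rewrite -(subnK le_t) iterD iter_tm_halted.
Qed.

(** Used to read a certificate off the first row of a tableau, where the constraints only enforce
    bits followed by blanks. *)
Lemma nth_leading_bits (A : finType) (cs : seq (cell A)) :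
  (forall j, j < size cs ->
     nth None cs j = None \/ exists b, nth None cs j = Some (inl b)) ->
  (forall j, nth None cs j = None -> nth None cs j.+1 = None) ->
  forall j, nth None cs j = nth None [seq Some (inl b) | b <- leading_bits cs] j.
Proof.
elim: cs => [|c cs IH] hc hn j; first by rewrite /= !nth_nil.
have [c0|[b c0]] := hc 0 isT; rewrite /= in c0; rewrite c0 /=.
  rewrite nth_nil; elim: j => //= j IHj.
  by move: (hn j); rewrite c0; apply.
case: j => //= j; apply: IH => [i lti|i]; first exact: (hc i.+1).
exact: (hn i.+1).
Qed.

Lemma size_leading_bits (A : finType) (cs : seq (cell A)) :
  size (leading_bits cs) <= size cs.
Proof. by elim: cs => //= -[[b|a]|] cs IH. Qed.

Definition bit_cells (A : finType) (s : seq bool) : seq (cell A) :=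
  [seq Some (inl b) | b <- s].

Lemma nth_pair_code_flag (A : finType) x y j : j < size x ->
  nth None (bit_cells A (pair_code x y)) j.*2 = Some (inl true).
Proof. by elim: x j => //= b x IH [|j] //= ltj; apply: IH. Qed.

Lemma nth_pair_code_bit (A : finType) x y j : j < size x ->
  nth None (bit_cells A (pair_code x y)) j.*2.+1 = Some (inl (nth false x j)).
Proof. by elim: x j => //= b x IH [|j] //= ltj; apply: IH. Qed.

Lemma nth_pair_code_end (A : finType) x y j :
  nth None (bit_cells A (pair_code x y)) ((size x).*2 + j) =
  nth None (bit_cells A (false :: y)) j.
Proof. by elim: x. Qed.

Lemma size_pair_code x y : size (pair_code x y) = ((size x).*2 + size y).+1.
Proof. by elim: x => //= b x ->. Qed.

(** * Tableaux of a machine as locally constrained assignments *)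

Section Tableau.
Variables (M : TM) (T n m : nat).

(* The tableau stores the cells at distance at most [B] from each head.  The
   cells at the border of the window are left unconstrained: what they contain
   cannot reach the head within [T] steps. *)
Let B := (T + n.*2 + m).+2.
Let W := (B + B).+1.
Let k := (tm_tapes M).+1.
Notation symbol := (cell (tm_work M)).

(** States and symbols share one domain, so that all variables of the constraint system have the
    same type. *)
Definition tab_val : finType := (tm_state M + symbol)%type.
(** [None] is the place of the control state. *)
Definition tab_pos : finType := option ('I_k * 'I_W).
Definition tab_var : finType := ('I_T.+1 * tab_pos)%type.
(** [None] is the acceptance constraint; [Some v] governs the variable [v]. *)
Definition tab_con : finType := option tab_var.
(* [None]: the constrained variable itself; [Some (inl _)]: control state and
   scanned symbols one step before; [Some (inr _)]: the cell at the same place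
   and its two neighbours one step before. *)
Definition tab_loc : finType := option (option 'I_k + option bool)%type.

Definition center : 'I_W := inord B.

Definition tab_near (p : tab_pos) (a : option 'I_k + option bool) : tab_pos :=
  match a, p with
  | inl None, _ => None
  | inl (Some i), _ => Some (i, center)
  | inr _, None => None
  | inr None, Some ip => Some ip
  | inr (Some b), Some ip =>
      Some (ip.1, if b then inord ip.2.+1 else inord ip.2.-1)
  end.

Definition tab_scope (c : tab_con) (a : tab_loc) : tab_var :=
  match c, a with
  | None, _ => (ord_max, Some (ord0, center))
  | Some v, None => v
  | Some v, Some a => (inord v.1.-1, tab_near v.2 a)
  end.

Definition val_state (d : tab_val) : tm_state M :=
  if d is inl q then q else tm_start M.
Definition val_cell (d : tab_val) : symbol := if d is inr c then c else None.

(** The new content of a coordinate is the old content at that coordinate plus the shift. If this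
    sum is 0, the cell is the one just scanned and holds the written symbol. *)
Definition tab_upd (p : tab_pos) (w : option 'I_k + option bool -> tab_val) :
    tab_val :=
  let q := val_state (w (inl None)) in
  if tm_halt q then w (inr None) else
  let r := tm_trans q [ffun i => val_cell (w (inl (Some i)))] in
  match p with
  | None => inl r.1
  | Some ip =>
      let cm := r.2 ip.1 in
      let near := match cm.2 with
        | MoveLeft => Some false | Stay => None | MoveRight => Some true end in
      if (ip.2%:Z - B%:Z + shift cm.2 == 0)%R then inr cm.1
      else w (inr near)
  end.

(** The first row must be a [pair_code] with the bits of the input left free at odd offsets and at
    most [m] certificate bits after the separator. A blank in the certificate zone forces a blank to
    its right: [next] lies in the same row, because the time before 0 is truncated to 0. *)
Definition tab_init_ok (p : tab_pos) (d next : tab_val) : bool :=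
  match p with
  | None => d == inl (tm_start M)
  | Some (i, o) =>
      if (i == ord0) && (B <= o) then
        let j := o - B in
        if j < n.*2 then (if odd j then true else d == inr (Some (inl true)))
        else if j == n.*2 then d == inr (Some (inl false))
        else if j <= n.*2 + m then
          if d is inr (Some (inl _)) then true
          else (d == inr None) && (next == inr None)
        else d == inr None
      else d == inr None
  end.

(** The trusted window loses one cell on either side per step. *)
Definition tab_active (v : tab_var) : bool :=
  if v.2 is Some ip then (v.1 <= ip.2) && (v.1 + ip.2 < W) else true.

Definition tab_allowed (c : tab_con) (w : {ffun tab_loc -> tab_val}) : bool :=
  match c with
  | None => w None == inr (Some (inl true))
  | Some v =>
      if v.1 == 0 :> nat then tab_init_ok v.2 (w None) (w (Some (inr (Some true))))
      else tab_active v ==> (w None == tab_upd v.2 (fun a => w (Some a)))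
  end.

Definition conf_val (c : config M) (p : tab_pos) : tab_val :=
  match p with
  | None => inl c.1
  | Some ip => inr (tget (c.2 ip.1) (ip.2%:Z - B%:Z)%R)
  end.

Lemma centerE : center = B :> nat.
Proof. by rewrite /center inordK // /W; lia. Qed.

Lemma conf_val_step c (p : tab_pos) :
  (if p is Some ip then 0 < ip.2 /\ ip.2.+1 < W else True) ->
  conf_val (tm_step c) p = tab_upd p (fun a => conf_val c (tab_near p a)).
Proof.
rewrite /tab_upd /tm_step /=; case: ifP => [hq|hq]; first by case: p.
have -> : [ffun i => val_cell (inr (tget (c.2 i) (center%:Z - B%:Z)%R))]
          = [ffun i => thead (c.2 i)].
  by apply/ffunP => i; rewrite !ffunE centerE GRing.subrr.
case: p => [[i p]|] //= [p0 p1]; rewrite ffunE tget_step.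
move: ((tm_trans _ _).2 i) => [s mv] /=; case: ifP => // _.
case: mv; rewrite /shift /= ?GRing.addr0 //.
  by rewrite inordK; [congr (inr (tget _ _)); lia|lia].
by rewrite inordK //; congr (inr (tget _ _)); lia.
Qed.

Lemma eq_tab_upd p w w' : w =1 w' -> tab_upd p w = tab_upd p w'.
Proof. by move=> eqw; rewrite (funext eqw). Qed.

Lemma conf_val_init s i (o : 'I_W) :
  conf_val (tm_init M s) (Some (i, o)) =
  inr (if (i == ord0) && (B <= o) then nth None (bit_cells _ s) (o - B) else None).
Proof.
rewrite /= ffunE; case: (leqP B o) => leBo; rewrite ?andbF ?andbT.
  rewrite (_ : (o%:Z - B%:Z)%R = Posz (o - B)) ?tget_tape_of_bits; last by lia.
  by case: ifP => //=; rewrite nth_nil.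
have -> : (o%:Z - B%:Z)%R = Negz (B - o).-1 by lia.
by rewrite /= nth_nil.
Qed.

Definition input_var (j : 'I_n) : tab_var :=
  (ord0, Some (ord0, inord (B + j.*2.+1))).

Lemma tab_complete x y : size x = n -> size y <= m ->
  thead ((iter T (@tm_step M) (tm_init M (pair_code x y))).2 ord0) =
    Some (inl true) ->
  exists tab : tab_var -> tab_val,
    (forall c, tab_allowed c [ffun a => tab (tab_scope c a)]) /\
    forall j : 'I_n, tab (input_var j) = inr (Some (inl (nth false x j))).
Proof.
move=> xn ym; set c0 := tm_init M _ => acc.
exists (fun v : tab_var => conf_val (iter v.1 (@tm_step M) c0) v.2); split; last first.
  move=> j; have ltj := ltn_ord j.
  rewrite /input_var conf_val_init /= inordK; last by rewrite /W /B; lia.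
  by rewrite leq_addr addKn nth_pair_code_bit // xn.
case=> [[t p]|] /=; last by rewrite ffunE /= centerE GRing.subrr /= acc.
case: eqP => [t0|/eqP t0]; last first.
  apply/implyP => act; rewrite ffunE /=; apply/eqP.
  have {1}-> : t = t.-1.+1 :> nat by lia.
  rewrite iterS conf_val_step.
    by apply: eq_tab_upd => a; rewrite ffunE /= inordK //; have := ltn_ord t; lia.
  by move: act; rewrite /tab_active /=; case: p => // -[i p] /=; lia.
rewrite !ffunE /= t0 inordK //=; case: p => [[i o]|]; last exact: eqxx.
rewrite /tab_near !conf_val_init /tab_init_ok.
case: (boolP ((i == ord0) && (B <= o))) => [/andP [-> leBo]|_]; last exact: eqxx.
rewrite /=; set j := o - B.
case: (ltnP j n.*2) => [ltj|lej].
  case: ifP => // /negbT oj; rewrite -(odd_double_half j) (negbTE oj) add0n.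
  by rewrite nth_pair_code_flag ?eqxx // xn ltn_half_double.
have endE r : nth None (bit_cells (tm_work M) (pair_code x y)) (n.*2 + r) =
    nth None (bit_cells _ (false :: y)) r by rewrite -xn nth_pair_code_end.
have [r jE] : exists r, j = n.*2 + r by exists (j - n.*2); rewrite subnKC.
rewrite jE endE; case: r jE => [|r] jE; first by rewrite addn0 eqxx /= eqxx.
rewrite -[X in _ == X]addn0 eqn_add2l leq_add2l /=.
case: (ltnP r m) => [ltr|ger]; last first.
  by rewrite nth_default ?eqxx // size_map; lia.
have oW : o.+1 < W by move: jE leBo; rewrite /j /W /B; lia.
rewrite inordK // leqW //.
have -> : o.+1 - B = n.*2 + r.+2 by rewrite subSn // -/j jE !addnS.
rewrite endE /=; case: (ltnP r (size y)) => lty.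
  by rewrite (nth_map false).
by rewrite !nth_default ?size_map ?eqxx // leqW.
Qed.

Variable tab : tab_var -> tab_val.
Hypothesis tabP : forall c, tab_allowed c [ffun a => tab (tab_scope c a)].

(** By induction on time: everything an active variable depends on is active one step earlier, since
    the window shrinks by exactly the reach of a head move. *)
Lemma tab_run c0 :
  (forall p, tab (ord0, p) = conf_val c0 p) ->
  forall v : tab_var, tab_active v -> tab v = conf_val (iter v.1 (@tm_step M) c0) v.2.
Proof.
move=> h0 [[t ltt] p] /=; elim: t ltt p => [|t IH] ltt p act.
  by rewrite -h0; congr (tab (_, _)); apply/val_inj.
have := tabP (Some (Ordinal ltt, p)); rewrite /= act /= => /eqP.
rewrite !ffunE /= => ->; rewrite conf_val_step; last first.
  by move: act; rewrite /tab_active /=; case: p => // -[i p] /=; lia.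
have tE : inord t = Ordinal (ltnW ltt) by apply/val_inj; rewrite /= inordK // ltnW.
apply: eq_tab_upd => a; rewrite ffunE /= tE IH //.
have actC : (t <= center) && (t + center < W) by rewrite centerE /W /B; lia.
case: p act => [[i p]|]; rewrite /tab_active /=; last first.
  by case: a => [[j|]|[a|]].
case: a => [[j|]|[[]|]] //= act; last by lia.
  by rewrite inordK; lia.
by rewrite inordK; lia.
Qed.
Lemma tab_sound x : size x = n ->
  (forall j : 'I_n, tab (input_var j) = inr (Some (inl (nth false x j)))) ->
  exists2 y, size y <= m &
    thead ((iter T (@tm_step M) (tm_init M (pair_code x y))).2 ord0) =
    Some (inl true).
Proof.
move=> xn tabx.
pose row o : tab_val := tab (ord0, Some (ord0, inord (B + o))).
(* The certificate zone of the first row; its leading bits form [y]. *)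
pose cs := mkseq (fun j => val_cell (row (n.*2 + j).+1)) m.
have rowP o : o <= n.*2 + m ->
    tab_init_ok (Some (ord0, inord (B + o))) (row o) (row o.+1).
  move=> leo; have := tabP (Some (ord0, Some (ord0, inord (B + o)))).
  rewrite /= !ffunE /= inordK; last by rewrite /W /B; lia.
  by rewrite /row addnS (_ : inord 0 = ord0) //; apply/val_inj; rewrite /= inordK.
have inW o : o <= n.*2 + m -> (inord (B + o) : 'I_W) = B + o :> nat.
  by move=> leo; rewrite inordK // /W /B; lia.
have yP j : j < m -> (exists b, row (n.*2 + j).+1 = inr (Some (inl b))) \/
    row (n.*2 + j).+1 = inr None /\ row (n.*2 + j).+2 = inr None.
  move=> ltj; have le1 : (n.*2 + j).+1 <= n.*2 + m by lia.
  have := rowP _ le1; rewrite /tab_init_ok inW // eqxx leq_addr addKn /= le1.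
  have -> : ((n.*2 + j).+1 < n.*2) = false by lia.
  have -> : ((n.*2 + j).+1 == n.*2) = false by lia.
  case: (row (n.*2 + j).+1) => [q|[[b|a]|]] //= => [_|/eqP ->].
    by left; exists b.
  by right.
have csE j : j < m -> row (n.*2 + j).+1 = inr (nth None cs j).
  move=> ltj; rewrite nth_mkseq //.
  by case: (yP j ltj) => [[b ->]|[-> _]].
have ycells := @nth_leading_bits _ cs; set y := leading_bits cs in ycells.
have ym : size y <= m.
  rewrite -(size_mkseq (fun j => val_cell (row (n.*2 + j).+1)) m).
  exact: size_leading_bits.
exists y => //.
have rowE p : tab (ord0, p) = conf_val (tm_init M (pair_code x y)) p.
  have := tabP (Some (ord0, p)); rewrite /= !ffunE /=.
  case: p => [[i o]|]; last by move/eqP.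
  rewrite conf_val_init /tab_init_ok; case: ifP => [|_ /eqP //].
  case/andP => /eqP -> leBo; have ltoW := ltn_ord o.
  have oE : o = inord (B + (o - B)) by apply/val_inj; rewrite /= inordK ?subnKC.
  rewrite [o in tab (_, Some (_, o))]oE -/(row _); set j := o - B.
  case: (ltnP j n.*2) => [ltj _|lej].
    have ltn2 : j./2 < n by rewrite ltn_half_double.
    case: (boolP (odd j)) => oj.
      have jE : j = j./2.*2.+1 by lia.
      have := tabx (Ordinal ltn2); rewrite /input_var /= -jE -/(row j) => ->.
      by rewrite [in RHS]jE nth_pair_code_bit ?xn.
    have jE : j = j./2.*2 by lia.
    have lej : j <= n.*2 + m by lia.
    have := rowP _ lej; rewrite /tab_init_ok inW // eqxx leq_addr addKn /= ltj.
    by rewrite (negbTE oj) => /eqP ->; rewrite [in RHS]jE nth_pair_code_flag ?xn.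
  have endE r : nth None (bit_cells (tm_work M) (pair_code x y)) (n.*2 + r) =
    nth None (bit_cells _ (false :: y)) r by rewrite -xn nth_pair_code_end.
  have [r jE] : exists r, j = n.*2 + r by exists (j - n.*2); rewrite subnKC.
  rewrite jE endE; case: r jE => [|r] jE; first by rewrite addn0 eqxx => /eqP.
  rewrite -[X in _ == X]addn0 eqn_add2l leq_add2l /=.
  case: (ltnP r m) => [ltr _|ger /eqP ->]; last first.
    by rewrite nth_default // size_map; lia.
  rewrite addnS csE // ycells // => [l|l eql].
    rewrite size_mkseq => ltl.
    case: (yP l ltl) => [[b hb]|[hl _]]; rewrite nth_mkseq // ?hb ?hl.
      by right; exists b.
    by left.
  case: (ltnP l.+1 m) => ltl; last by rewrite nth_default // size_mkseq.
  have ltl' := ltnW ltl; move: eql; rewrite !nth_mkseq //.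
  by rewrite addnS; case: (yP l ltl') => [[b ->]|[_ ->]].
(* [B] exceeds [T], so the head cell is still trusted in the last row. *)
have act : tab_active ((ord_max, Some (ord0, center)) : tab_var).
  by rewrite /tab_active /= centerE /W /B; lia.
have := tab_run rowE act; rewrite /= centerE GRing.subrr /=.
by have := tabP None; rewrite /= ffunE => /eqP -> [].
Qed.
End Tableau.

(** * The Cook-Levin theorem, as local constraints over a fixed domain *)

(** The scope [A] and the domain [D] are parameters because they will be independent of the input
    length: each constraint then has a constant number of value tables. *)
Record csp (A D : finType) := Csp {
  csp_var : finType;
  csp_con : finType;
  csp_scope : csp_con -> A -> csp_var;
  csp_allowed : csp_con -> pred {ffun A -> D} }.

Definition csp_sat (A D : finType) (P : csp A D) (s : csp_var P -> D) : Prop :=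
  forall c, csp_allowed c [ffun a => s (csp_scope c a)].

Lemma NP_csp (L : language) : class_NP L ->
  exists (A D : finType) (bit : bool -> D) (q : nat -> nat),
    poly_bounded q /\
    forall n, exists (P : csp A D) (z : 'I_n -> csp_var P),
      [/\ #|csp_var P| <= q n, #|csp_con P| <= q n
        & forall x, size x = n -> (L x <->
            exists s, csp_sat s /\ forall j, s (z j) = bit (nth false x j))].
Proof.
case=> [V [p [[f [[M [pM MP]] fP]] LP]]].
pose m n : nat := (p.[n])%R.
pose T n : nat := (pM.[(n.*2 + m n).+1])%R.
pose w n := ((T n + n.*2 + m n).+2 + (T n + n.*2 + m n).+2).+1.
pose q n := ((T n).+1 * ((tm_tapes M).+1 * w n).+1).+1.
exists (tab_loc M), (tab_val M), (fun b => inr (Some (inl b))), q; split.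
  have pm : poly_bounded m by rewrite /m; poly_bound.
  have pT : poly_bounded T by rewrite /T; poly_bound.
  by rewrite /q /w; poly_bound.
move=> n.
exists (@Csp (tab_loc M) (tab_val M) _ _ (@tab_scope M (T n) n (m n))
          (@tab_allowed M (T n) n (m n))), (@input_var M (T n) n (m n)).
split=> [||x xn] /=.
- by rewrite card_prod card_option card_prod !card_ord leqnSn.
- by rewrite card_option card_prod card_option card_prod !card_ord leqnn.
(* The decider for [V] outputs exactly one bit, so acceptance is visible in the cell under the head
   of tape 0. *)
have accE y : size y <= m n -> (V (pair_code x y) <->
    thead ((iter (T n) (@tm_step M) (tm_init M (pair_code x y))).2 ord0) =
    Some (inl true)).
  move=> ym.
  have le : ((pM.[size (pair_code x y)])%R : nat) <= T n.
    by apply: horner_nat_mono; rewrite size_pair_code xn; lia.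
  have [_ /=] := tm_computes_in_le le (MP (pair_code x y)).
  rewrite /tm_output fP; move: (thead _) => [[b|a]|] //= [-> _].
  by split=> [->|[]].
rewrite LP xn; split=> [[y [ym Vy]]|[s [ss sx]]].
  by apply: (@tab_complete M (T n) n (m n) x y xn ym); apply/accE.
have [y ym acc] := tab_sound ss xn sx.
by exists y; split=> //; apply/accE.
Qed.

(** * From multicoloured hitting sets to identifying codes *)

Section Gadget.
Variables (U V J : finType) (color : U -> V) (S : J -> {set U}) (b : nat).
Variable addr : U + (V + J) -> {ffun 'I_b.+2 -> bool}.

(** A probe asks for one bit of an address. Of the two probes at each position an item sees exactly
    one; with at least two positions it sees at least two probes and misses at least two. *)
Definition probe : finType := ('I_b.+2 * bool)%type.

(* The vertices, in this order: the probes, which every small code must contain;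
   a clique forcing the probes into the code; the elements to choose from; and
   one pair of twins per colour and per set, separated by the elements of that
   colour or set only. *)
Definition gadget : finType :=
  ((probe + option probe) + (U + (V + J) * bool))%type.

Definition vF (f : probe) : gadget := inl (inl f).
Definition vC (o : option probe) : gadget := inl (inr o).
Definition vU (u : U) : gadget := inr (inl u).
Definition vP (p : V + J) (c : bool) : gadget := inr (inr (p, c)).

Definition separates (p : V + J) (u : U) : bool :=
  match p with inl v => color u == v | inr j => u \in S j end.

Definition probed (x : U + (V + J)) (f : probe) : bool := addr x f.1 == f.2.

Definition gadget_edge : rel gadget := fun x y =>
  match x, y with
  | inl (inl _), inl (inl _) => false
  | inl (inl f), inl (inr o) => o != Some f
  | inl (inl f), inr (inl u) => probed (inl u) f
  | inl (inl f), inr (inr (p, _)) => probed (inr p) f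
  | inl (inr o), inl (inl f) => o != Some f
  | inl (inr o), inl (inr o') => o != o'
  | inl (inr _), inr _ => false
  | inr (inl u), inl (inl f) => probed (inl u) f
  | inr (inl _), inl (inr _) => false
  | inr (inl _), inr (inl _) => false
  | inr (inl u), inr (inr (p, c)) => c && separates p u
  | inr (inr (p, _)), inl (inl f) => probed (inr p) f
  | inr (inr _), inl (inr _) => false
  | inr (inr (p, c)), inr (inl u) => c && separates p u
  | inr (inr (p, c)), inr (inr (p', c')) => (p == p') && (c != c')
  end.

Lemma gadget_edge_sym : symmetric gadget_edge.
Proof.
move=> [[f|o]|[u|[p c]]] [[f'|o']|[u'|[p' c']]] //=; first by rewrite eq_sym.
by rewrite eq_sym [c == _]eq_sym.
Qed.

Lemma gadget_edge_irr : irreflexive gadget_edge.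
Proof. by move=> [[f|o]|[u|[p c]]] //=; rewrite ?eqxx. Qed.

Definition gadget_size : nat := #|V| + #|probe|.

(** The closed neighbourhoods of the clique vertices [vC None] and [vC (Some f)] differ in [vF f]
    only. *)
Lemma code_probe I f : identifying_code gadget_edge I -> vF f \in I.
Proof.
case=> _ sepI; apply: contraT => nIf.
have : vC None <> vC (Some f) by [].
move/sepI; case; apply/setP => -[[f'|o]|[u|[p c]]]; rewrite !inE //=.
  have [->|nf] := eqVneq f' f; first by rewrite (negbTE nIf) !andbF.
  by rewrite (inj_eq Some_inj) eq_sym nf.
by rewrite !(inj_eq inr_inj, inj_eq inl_inj) ![_ == o]eq_sym !orbN.
Qed.

(** The twins [vP p false] and [vP p true] are adjacent and see the same probes; only the second
    sees the elements separating [p]. *)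
Lemma code_separates I p : identifying_code gadget_edge I ->
  exists2 u, separates p u & vU u \in I.
Proof.
case=> _ sepI.
have : vP p false <> vP p true by [].
move/sepI => neq.
have [/existsP [u /andP [pu uI]]|no] := boolP [exists u, separates p u && (vU u \in I)].
  by exists u.
case: neq; apply/setP => -[[f|o]|[u|[p' c]]]; rewrite !inE //=.
  by move: no; rewrite negb_exists => /forallP /(_ u) /negbTE ->.
congr (_ && _); rewrite !(inj_eq inr_inj) !xpair_eqE [p == p']eq_sym.
by case: (p' == p); case: c.
Qed.

Lemma gadget_sound I : identifying_code gadget_edge I -> #|I| <= gadget_size ->
  exists s : V -> U, (forall v, color (s v) = v) /\
                     forall j, exists v, s v \in S j.
Proof.
move=> codeI leI.
have pickV v : {u | color u == v & vU u \in I}.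
  by apply/cid2; apply: (code_separates (inl v)).
pose s v := s2val (pickV v).
have sv v : color (s v) = v by apply/eqP; apply: (s2valP (pickV v)).
have sI v : vU (s v) \in I by apply: (s2valP' (pickV v)).
exists s; split=> // j.
have [u uj uI] := code_separates (inr j) codeI.
(* The probes and one element per colour already use up the budget, so the code contains nothing
   else, and the element hitting [S j] must be one of the chosen ones. *)
pose sel := [set vU (s v) | v in V] :|: [set vF f | f in probe].
have selI : sel \subset I.
  apply/subsetP => x; rewrite inE => /orP [] /imsetP [y _ ->] //.
  exact: code_probe.
have selE : #|sel| = gadget_size.
  rewrite cardsU disjoint_setI0 ?cards0 ?subn0 ?card_imset //.
  - by move=> f f' [].
  - by move=> v v' [eqs]; rewrite -(sv v) eqs sv.
  - rewrite -setI_eq0; apply/eqP/setP => x; rewrite !inE; apply/andP => -[].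
    by case/imsetP => v _ -> /imsetP [].
have : vU u \in sel.
  by rewrite (_ : sel = I) //; apply/eqP; rewrite eqEcard selI selE.
rewrite inE => /orP [] /imsetP [v _] // [uE].
by exists v; rewrite -uE.
Qed.

Hypothesis addr_inj : injective addr.

Lemma other_probe (f f' : probe) : exists2 h : probe, h != f & h != f'.
Proof.
have : ~~ ([set: probe] \subset [set f; f']).
  apply/negP => /subset_leq_card.
  rewrite cardsT card_prod card_ord card_bool cards2; lia.
by case/subsetPn => h _; rewrite !inE negb_or => /andP [hf hf']; exists h.
Qed.

(** The probes in the closed neighbourhood of [x]. *)
Definition trace (x : gadget) (f : probe) : bool :=
  match x with
  | inl (inl f') => f == f'
  | inl (inr o) => o != Some f
  | inr (inl u) => probed (inl u) f
  | inr (inr (p, _)) => probed (inr p) f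
  end.

Lemma probed_two y : exists f f', [/\ f != f', probed y f & probed y f'].
Proof.
exists (ord0, addr y ord0), (lift ord0 ord0, addr y (lift ord0 ord0)).
by split; rewrite /probed ?eqxx.
Qed.

Lemma unprobed_two y : exists f f', [/\ f != f', ~~ probed y f & ~~ probed y f'].
Proof.
exists (ord0, ~~ addr y ord0), (lift ord0 ord0, ~~ addr y (lift ord0 ord0)).
by split; rewrite /probed //=; case: (addr _ _).
Qed.

Lemma trace_probe_item (f : probe) y : (forall h, (h == f) = probed y h) -> False.
Proof.
have [h [h' [neq hy hy']]] := probed_two y => eqt.
by move: (eqt h) (eqt h') neq; rewrite hy hy' => /eqP -> /eqP ->; rewrite eqxx.
Qed.

Lemma trace_clique_item o y : (forall h : probe, (o != Some h) = probed y h) -> False.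
Proof.
have [h [h' [neq /negbTE hy /negbTE hy']]] := unprobed_two y => eqt.
move: (eqt h) (eqt h') neq; rewrite hy hy' => /eqP -> /eqP [->].
by rewrite eqxx.
Qed.

Lemma trace_probe_clique (f : probe) o : (forall h, (h == f) = (o != Some h)) -> False.
Proof.
move=> eqt; have [h hf ho] := other_probe f (odflt f o).
move: (eqt h); rewrite (negbTE hf); case: o ho {eqt} => //= f' hf'.
by rewrite (inj_eq Some_inj) eq_sym hf'.
Qed.

Lemma probed_inj y y' : (forall h, probed y h = probed y' h) -> y = y'.
Proof.
move=> eqt; apply/addr_inj/ffunP => i.
by have := eqt (i, addr y i); rewrite /probed /= eqxx => /esym/eqP.
Qed.

(** Traces of probes are singletons, those of clique vertices miss at most one probe, and those of
    items contain and miss at least two. The kinds are thus distinguishable, and within a kind only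
    twins share a trace. *)
Lemma trace_inj x y : (forall f, trace x f = trace y f) ->
  x = y \/ exists p, exists c, x = vP p c /\ y = vP p (~~ c).
Proof.
case: x y => [[f|o]|[u|[p c]]] [[f'|o']|[u'|[p' c']]] /= eqt;
  have eqt' h := esym (eqt h).
all: try (by exfalso; apply: trace_probe_item eqt).
all: try (by exfalso; apply: trace_probe_item eqt').
all: try (by exfalso; apply: trace_clique_item eqt).
all: try (by exfalso; apply: trace_clique_item eqt').
all: try (by exfalso; apply: trace_probe_clique eqt).
all: try (by exfalso; apply: trace_probe_clique eqt').
all: try (by have := probed_inj eqt).
all: clear eqt'.
- by left; have := eqt f; rewrite eqxx => /esym/eqP ->.
- left; case: o o' eqt => [f|] [f'|] eqt //.
  + by have := eqt f; rewrite eqxx (inj_eq Some_inj); case: eqP => // ->.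
  + by have := eqt f; rewrite eqxx.
  + by have := eqt f'; rewrite eqxx.
- by left; have [->] := probed_inj eqt.
- have [->] := probed_inj eqt; case: (eqVneq c c') => [->|neq]; first by left.
  by right; exists p', c; split=> //; congr (vP _ _); case: c c' neq => [] [].
Qed.

Lemma gadget_complete (s : V -> U) :
  (forall v, color (s v) = v) -> (forall j, exists v, s v \in S j) ->
  exists I, identifying_code gadget_edge I /\ #|I| <= gadget_size.
Proof.
move=> sv sS.
pose I := [set vU (s v) | v in V] :|: [set vF f | f in probe].
have FI f : vF f \in I by rewrite inE; apply/orP; right; apply: imset_f.
have sI v : vU (s v) \in I by rewrite inE; apply/orP; left; apply: imset_f.
have traceE x f : (vF f \in closed_nbhd gadget_edge x :&: I) = trace x f.
  by rewrite inE FI andbT inE; case: x => [[f'|o]|[u|[p c]]] //=; rewrite orbF.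
have traceN x : exists f, trace x f.
  case: x => [[f|o]|[u|[p c]]] /=.
  - by exists f.
  - have [h _ ho] := other_probe (odflt (ord0, true) o) (odflt (ord0, true) o).
    by exists h; case: o ho => //= f hf; rewrite (inj_eq Some_inj) eq_sym.
  - by have [f [_ [_ hf _]]] := probed_two (inl u); exists f.
  - by have [f [_ [_ hf _]]] := probed_two (inr p); exists f.
exists I; split; last first.
  apply: leq_trans (leq_card_setU _ _) _.
  by apply: leq_add; apply: leq_imset_card.
split=> [x|x y neq eqI].
  by have [f] := traceN x; rewrite -traceE => /[swap] ->; rewrite inE.
have [|//|[p [c [xE yE]]]] := @trace_inj x y.
  by move=> f; rewrite -!traceE eqI.
(* Twins are told apart by the element chosen for their colour, or by a chosen element hitting their
   set. *)
have [v pv] : exists v, separates p (s v).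
  by case: p {xE yE} => [v|j] /=; [exists v; rewrite sv|].
move/setP: eqI => /(_ (vU (s v))); rewrite xE yE !(in_setI, sI, andbT) !inE /= pv.
by case: c {xE yE}.
Qed.
End Gadget.

(** * The disjunction of many NP questions as one small-parameter instance *)

Section Disjunction.
Variables (A D : finType) (P : csp A D) (bit : bool -> D) (n t : nat).
Variable z : 'I_n -> csp_var P.

Definition or_color : finType := option (csp_var P).
(* Besides the values of the variables there is one extra colour, whose
   elements are the indices of the [t] inputs. *)
Definition or_elem : finType := (csp_var P * D + 'I_t)%type.
Definition or_set : finType :=
  (csp_con P * {ffun A -> D} + 'I_n * bool)%type.

Definition or_colorof (u : or_elem) : or_color :=
  if u is inl (v, _) then Some v else None.

(** The set of [(c, w)] is hit unless the scope of [c] carries precisely the forbidden table [w];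
    for an allowed table it is hit trivially. The set of [(j, c)] expresses an implication: if bit
    [j] of the selected input is [c], then [z j] has the value [bit c]. *)
Definition or_family (X : 'I_t -> n.-tuple bool) (j : or_set) : {set or_elem} :=
  match j with
  | inl (c, w) =>
      if csp_allowed c w then setT else
      [set u | if u is inl (v, d) then
                 [exists a, (csp_scope c a == v) && (d != w a)] else false]
  | inr (j, c) =>
      [set u | match u with
               | inl (v, d) => (v == z j) && (d == bit c)
               | inr i => tnth (X i) j != c
               end]
  end.

Lemma or_familyP X :
  (exists s, (forall v, or_colorof (s v) = v) /\
             forall j, exists v, s v \in or_family X j) <->
  exists i s, @csp_sat A D P s /\ forall j, s (z j) = bit (tnth (X i) j).
Proof.
split=> [[s [sc sS]]|[i [s [ss sz]]]]; last first.
  exists (fun v => if v is Some v then inl (v, s v) else inr i); split=> [[]//|].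
  case=> [[c w]|[j c]] /=.
    case: (boolP (csp_allowed c w)) => cw; first by exists None; rewrite inE.
    have [/forallP eqw|] := boolP [forall a, s (csp_scope c a) == w a].
      have := ss c; rewrite (_ : [ffun a => _] = w) ?(negbTE cw) //.
      by apply/ffunP => a; rewrite ffunE; apply/eqP.
    case/forallPn => a na; exists (Some (csp_scope c a)); rewrite inE.
    by apply/existsP; exists a; rewrite eqxx.
  have [<-|neq] := eqVneq (tnth (X i) j) c; last by exists None; rewrite inE.
  by exists (Some (z j)); rewrite inE sz !eqxx.
have [i sN] : exists i, s None = inr i.
  by have := sc None; case: (s None) => [[]|i] //; exists i.
have val_s v : {d | s (Some v) = inl (v, d)}.
  by apply/cid; have := sc (Some v); case: (s _) => // -[v' d] /= [->]; exists d.
pose s' v := sval (val_s v).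
have s'E v : s (Some v) = inl (v, s' v) by apply: (svalP (val_s v)).
exists i, s'; split=> [c|j].
  apply: contraT => nc.
  (* The set of the violated table would need a variable whose value differs from itself. *)
  have [v] := sS (inl (c, [ffun a => s' (csp_scope c a)])).
  rewrite /or_family (negbTE nc) inE; case: v => [v|]; last by rewrite sN.
  by rewrite s'E => /existsP [a /andP [/eqP <-]]; rewrite ffunE eqxx.
have [[v|]] := sS (inr (j, tnth (X i) j)); rewrite inE; last by rewrite sN eqxx.
by rewrite s'E => /andP [/eqP <- /eqP].
Qed.

Variables (b : nat) (addr : or_elem + (or_color + or_set) -> {ffun 'I_b.+2 -> bool}).

Notation or_vertex := (gadget or_elem or_color or_set b).
Definition or_edge X : rel or_vertex :=
  gadget_edge or_colorof (or_family X) addr.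

(* An entry of the adjacency matrix is a constant, or bit [j] of input [i],
   possibly negated. *)
Definition query : Type := (bool + 'I_t * 'I_n * bool)%type.

Definition eval_query (X : 'I_t -> n.-tuple bool) (q : query) : bool :=
  match q with inl c => c | inr (i, j, c) => tnth (X i) j (+) c end.

(** The inputs affect only the adjacency between an index and the second twin of an input-bit set.
    All other entries are evaluated at an arbitrary tuple, here all zeros. *)
Definition or_query (x y : or_vertex) : query :=
  match x, y with
  | inr (inl (inr i)), inr (inr (inr (inr (j, c)), true)) => inr (i, j, c)
  | inr (inr (inr (inr (j, c)), true)), inr (inl (inr i)) => inr (i, j, c)
  | _, _ => inl (or_edge (fun=> [tuple of nseq n false]) x y)
  end.

Lemma or_queryE X x y : eval_query X (or_query x y) = or_edge X x y.
Proof.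
case: x y => [[f|o]|[[[v d]|i]|[[c|[[p w]|[j c]]] []]]]
  [[f'|o']|[[[v' d']|i']|[[c'|[[p' w']|[j' c']]] []]]] //=.
all: rewrite ?inE //; try by case: ifP => _; rewrite !inE.
- by case: (tnth _ _) c' => [] [].
- by case: (tnth _ _) c => [] [].
Qed.
End Disjunction.

Lemma injection_of_card (X Y : finType) :
  #|X| <= #|Y| -> exists f : X -> Y, injective f.
Proof.
move=> le; exists (fun x => enum_val (widen_ord le (enum_rank x))) => x x'.
by move/enum_val_inj/(congr1 val) => /= /val_inj/enum_rank_inj.
Qed.

(** * Isomorphism invariance and adjacency matrices *)

Lemma identifying_code_bij (T T' : finType) (f : T -> T') (e : rel T')
    (I : {set T'}) :
  bijective f -> identifying_code e I ->
  identifying_code (fun x y => e (f x) (f y)) (f @^-1: I).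
Proof.
case=> g fK gK [dom sep].
have E x y : (y \in closed_nbhd (fun x y => e (f x) (f y)) x :&: f @^-1: I) =
             (f y \in closed_nbhd e (f x) :&: I).
  by rewrite !inE (can_eq fK).
split=> [x|x y neq] eqI.
  apply: (dom (f x)); apply/setP => y; rewrite -(gK y) -E eqI !inE //.
apply: (sep (f x) (f y)) => [|]; first by move/(can_inj fK).
by apply/setP => w; rewrite -(gK w) -!E eqI.
Qed.

Lemma graph_code_map n (e : rel 'I_n) :
  graph_code e = [seq e p.1 p.2 | p <- [seq (i, j) | i <- enum 'I_n, j <- enum 'I_n]].
Proof. by rewrite /graph_code map_allpairs. Qed.

Lemma size_graph_code n (e : rel 'I_n) : size (graph_code e) = n * n.
Proof. by rewrite size_allpairs -!cardE card_ord. Qed.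

Lemma graph_code_inj n n' (e : rel 'I_n) (e' : rel 'I_n') (eqn : n = n') :
  graph_code e = graph_code e' ->
  forall i j, e i j = e' (cast_ord eqn i) (cast_ord eqn j).
Proof.
case: n' / eqn e' => e'; rewrite !graph_code_map => /eq_in_map eqe i j.
rewrite !cast_ord_id; apply: (eqe (i, j)); apply/allpairsP.
by exists (i, j); rewrite !mem_enum.
Qed.

Lemma IdentifyingCodeE (T : finType) (e : rel T) k :
  symmetric e -> irreflexive e ->
  IdentifyingCode
    (graph_code (fun i j : 'I_#|T| => e (enum_val i) (enum_val j)), k) <->
  exists I, identifying_code e I /\ #|I| <= k.
Proof.
move=> se ie; split=> [[n [e' [_ _ /= eqc [I [codeI leI]]]]]|[I [codeI leI]]].
  (* The order of the graph is recovered as the square root of the code length. *)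
  have eqn : #|T| = n.
    have := congr1 size eqc; rewrite !size_graph_code !mulnn => /eqP.
    by rewrite eqn_exp2r // => /eqP.
  have ee' := graph_code_inj eqn eqc.
  pose f x := cast_ord eqn (enum_rank x).
  have bf : bijective f.
    exists (fun i => enum_val (cast_ord (esym eqn) i)) => x.
      by rewrite /f cast_ordK enum_rankK.
    by rewrite /f enum_valK cast_ordKV.
  have ef : (fun x y => e' (f x) (f y)) = e.
    by apply/funext => x; apply/funext => y; rewrite -ee' !enum_rankK.
  exists (f @^-1: I); split; first by rewrite -ef; apply: identifying_code_bij.
  apply: leq_trans leI; rewrite -(card_imset _ (bij_inj bf)) subset_leq_card //.
  by apply/subsetP => x /imsetP [y]; rewrite inE => ? ->.
exists #|T|, (fun i j => e (enum_val i) (enum_val j)); split=> //.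
exists (enum_val @^-1: I); split.
  by apply: identifying_code_bij => //; apply: enum_val_bij.
apply: leq_trans leI; rewrite -(card_imset _ (@enum_val_inj _ _)) subset_leq_card //.
by apply/subsetP => x /imsetP [y]; rewrite inE => ? ->.
Qed.

(** The [t] inputs add elements but only a single colour, so [t] enters the parameter solely through
    the address length [b], which is logarithmic in the number of items. *)
Lemma NP_or_composition (L : language) : class_NP L ->
  exists q : nat -> nat, poly_bounded q /\
    forall n t b, q n + t <= 2 ^ b.+2 ->
    exists (N k : nat) (Q : 'I_N -> 'I_N -> query n t),
      [/\ N <= (q n).*2 + t + 4 * b.+3, k <= q n + b.+2.*2
        & forall X : 'I_t -> n.-tuple bool,
            IdentifyingCode (graph_code (fun i j => eval_query X (Q i j)), k) <->
            exists i, L (X i)].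
Proof.
move/NP_csp => [A [D [bit [q0 [pq0 cspP]]]]].
(* Bounds for the elements other than indices, the colours and the sets. *)
pose q n := q0 n * #|D| + (q0 n).+1 + (q0 n * #|D| ^ #|A| + n * 2).
exists q; split; first by rewrite /q; poly_bound.
move=> n t b leb; have [P [z [leV leC LP]]] := cspP n.
have cU : #|or_elem P t| <= q0 n * #|D| + t.
  by rewrite card_sum card_prod card_ord leq_add2r leq_mul.
have cV : #|or_color P| <= (q0 n).+1 by rewrite card_option ltnS.
have cJ : #|or_set P n| <= q0 n * #|D| ^ #|A| + n * 2.
  by rewrite card_sum !card_prod card_ord card_bool card_ffun leq_add2r leq_mul.
have [addr addr_inj] : exists f : or_elem P t + (or_color P + or_set P n) ->
    {ffun 'I_b.+2 -> bool}, injective f.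
  apply: injection_of_card; rewrite card_ffun card_bool card_ord.
  apply: leq_trans leb; rewrite -cardsT (_ : #|_| =
    #|or_elem P t| + (#|or_color P| + #|or_set P n|)); first by rewrite /q; lia.
  by rewrite cardsT card_sum; congr (_ + _); rewrite card_sum.
exists #|gadget (or_elem P t) (or_color P) (or_set P n) b|.
exists (gadget_size (or_color P) b).
exists (fun i j => or_query bit z addr (enum_val i) (enum_val j)); split.
- suff -> : #|gadget (or_elem P t) (or_color P) (or_set P n) b| =
      #|probe b| + #|probe b|.+1 +
      (#|or_elem P t| + (#|or_color P| + #|or_set P n|) * 2).
    by rewrite card_prod card_ord card_bool /q; lia.
  rewrite card_sum card_sum card_option; congr (_ + _).
  by rewrite card_sum card_prod card_bool; congr (_ + _ * _); rewrite card_sum.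
- by rewrite /gadget_size card_prod card_ord card_bool /q; lia.
move=> X; rewrite (_ : (fun i j => _) =
    (fun i j => or_edge bit z addr X (enum_val i) (enum_val j))); last first.
  by apply/funext => i; apply/funext => j; rewrite or_queryE.
rewrite IdentifyingCodeE; last 2 first.
- exact: gadget_edge_sym.
- exact: gadget_edge_irr.
have -> : (exists i, L (X i)) <->
    exists i s, @csp_sat A D P s /\ forall j, s (z j) = bit (tnth (X i) j).
  split=> -[i]; last first.
    case=> s [ss sz]; exists i; apply/LP; rewrite ?size_tuple //.
    by exists s; split=> // j; rewrite sz (tnth_nth false).
  case/LP; rewrite ?size_tuple // => s [ss sz]; exists i, s; split=> // j.
  by rewrite sz (tnth_nth false).
rewrite -or_familyP; split=> [[I [codeI leI]]|[s [sc sS]]].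
  exact: gadget_sound codeI leI.
exact: gadget_complete addr_inj s sc sS.
Qed.

(** * Distillation *)

Section Distillation.
Variables (X Y : finType) (t : nat) (Phi : {ffun 'I_t -> X} -> Y).

Definition slice (A : {set X}) (i : 'I_t) (y : Y) : {set X} :=
  [set f i | f : {ffun 'I_t -> X} in ffun_on (mem A) & Phi f == y].

Lemma card_family_le (F : 'I_t -> {set X}) h :
  (forall i, #|F i| <= h) -> #|family (fun i => mem (F i))| <= h ^ t.
Proof.
move=> leF; rewrite card_family -[X in _ <= _ ^ X]size_enum_ord.
by rewrite /image_mem; elim: (enum _) => //= i s IH; rewrite expnS leq_mul.
Qed.

(* The tuples over [A] with a given image lie in the product of their slices,
   so if all slices were small then there would be too few tuples. *)
Lemma large_slice (A : {set X}) : 0 < t -> #|Y| <= 2 ^ t -> A != set0 ->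
  exists i y, #|A| <= 2 * #|slice A i y|.
Proof.
move=> t0 leY; rewrite -card_gt0 => A0; apply: contrapT => no.
(* The largest [h] with [2 * h < #|A|]: a slice with more than [h] elements would already contain
   half of [A]. *)
pose h := #|A|.-1./2.
have leh i y : #|slice A i y| <= h.
  rewrite leqNgt; apply/negP => gth; apply: no; exists i, y.
  by rewrite /h in gth; lia.
have : #|[set f : {ffun 'I_t -> X} | f \in ffun_on (mem A)]| <= (2 * h) ^ t.
  rewrite -sum1dep_card (partition_big Phi predT) //= expnMn.
  apply: (@leq_trans (\sum_(y : Y) h ^ t)).
    apply: leq_sum => y _; rewrite sum1dep_card.
    apply: leq_trans (card_family_le (F := fun i => slice A i y) (leh^~ y)).
    apply: subset_leq_card; apply/subsetP => f; rewrite !inE => /andP [fA fy].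
    by apply/familyP => i; apply/imsetP; exists f; rewrite ?inE ?fA.
  by rewrite sum_nat_const leq_mul2r leY orbT.
have -> : #|[set f : {ffun 'I_t -> X} | f \in ffun_on (mem A)]| = #|A| ^ t.
  by rewrite cardsE card_ffun_on card_ord.
by rewrite leq_exp2r // /h; lia.
Qed.

(** Greedy choice: removing a slice with at least half of the elements halves the bound on [A], so
    [n] rounds suffice. Tuples of later rounds run over subsets of [A]. *)
Lemma distillation n (A : {set X}) : 0 < t -> #|Y| <= 2 ^ t -> #|A| < 2 ^ n ->
  exists es : seq ('I_t * Y), [/\ size es <= n,
    forall e, e \in es -> exists2 f : {ffun 'I_t -> X}, forall i, f i \in A & Phi f = e.2
  & forall x, x \in A -> exists e (f : {ffun 'I_t -> X}),
      [/\ e \in es, forall i, f i \in A, f e.1 = x & Phi f = e.2]].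
Proof.
move=> t0 leY; elim: n A => [|n IH] A leA.
  have A0 : A = set0 by apply/eqP; rewrite -cards_eq0; lia.
  by exists [::]; split=> // x; rewrite A0 inE.
have [A0|A0] := eqVneq A set0.
  by exists [::]; split=> // x; rewrite A0 inE.
have [i [y large]] := large_slice t0 leY A0.
have sliceP x : x \in slice A i y ->
    exists f : {ffun 'I_t -> X}, [/\ forall i, f i \in A, f i = x & Phi f = y].
  by case/imsetP => f; rewrite inE => /andP [/ffun_onP fA /eqP fy] ->; exists f.
have [|es [ses esP cov]] := IH (A :\: slice A i y).
  have : slice A i y \subset A.
    by apply/subsetP => x /sliceP [f [fA <- _]].
  by move/setIidPr => sA; rewrite cardsD sA; rewrite expnS in leA; lia.
exists ((i, y) :: es); split=> //= [e|x xA].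
  rewrite inE => /orP [/eqP ->|/esP [f fA fe]].
    have : slice A i y != set0 by rewrite -card_gt0; rewrite -card_gt0 in A0; lia.
    by case/set0Pn => x /sliceP [f [fA _ fy]]; exists f.
  by exists f => // l; have := fA l; rewrite inE => /andP [].
have [xs|xs] := boolP (x \in slice A i y).
  by have [f [fA fx fy]] := sliceP _ xs; exists (i, y), f; rewrite mem_head.
have [|e [f [ees fA fx fe]]] := cov x; first by rewrite inE xs.
exists e, f; split=> //; first by rewrite inE ees orbT.
by move=> l; have := fA l; rewrite inE => /andP [].
Qed.
End Distillation.

(** * A machine that replays the composition and the kernelization *)

Variant control :=
  | Parse of bool & bool & bool
  | Select
  | Skip of bool
  | Copy
  | Rewind
  | Fetch
  | Walk
  | Read
  | Push of bool & bool
  | Unary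
  | Compare
  | Done.

Definition control_code (c : control) :
    (bool * bool * bool) + (bool * bool) + bool + 'I_9 :=
  match c with
  | Parse o p r => inl (inl (inl (o, p, r)))
  | Push b n => inl (inl (inr (b, n)))
  | Skip l => inl (inr l)
  | Select => inr (@Ordinal 9 0 isT)
  | Copy => inr (@Ordinal 9 1 isT)
  | Rewind => inr (@Ordinal 9 2 isT)
  | Fetch => inr (@Ordinal 9 3 isT)
  | Walk => inr (@Ordinal 9 4 isT)
  | Read => inr (@Ordinal 9 5 isT)
  | Unary => inr (@Ordinal 9 6 isT)
  | Compare => inr (@Ordinal 9 7 isT)
  | Done => inr (@Ordinal 9 8 isT)
  end.

Definition control_decode (x : (bool * bool * bool) + (bool * bool) + bool + 'I_9) :
    control :=
  match x with
  | inl (inl (inl (o, p, r))) => Parse o p r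
  | inl (inl (inr (b, n))) => Push b n
  | inl (inr l) => Skip l
  | inr i =>
      nth Done [:: Select; Copy; Rewind; Fetch; Walk; Read; Unary; Compare] i
  end.

Lemma control_codeK : cancel control_code control_decode.
Proof. by case. Qed.

HB.instance Definition _ := Equality.copy control (can_type control_codeK).
HB.instance Definition _ := Choice.copy control (can_type control_codeK).
HB.instance Definition _ := Countable.copy control (can_type control_codeK).
HB.instance Definition _ : isFinite control := CanIsFinite control_codeK.

Definition tape_at (A : finType) (l cs : seq (cell A)) : tape A :=
  Tape l (head None cs) (behead cs).

Definition tape_op (A : finType) (t : tape A) (o : option (cell A) * move) :
    tape A :=
  tape_move (if o.1 is Some c then tape_write t c else t) o.2.

Section Verifier.
Variable MK : TM.
Notation symbol := (cell (tm_work MK)).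
Notation ktapes := {ffun 'I_(tm_tapes MK).+1 -> tape (tm_work MK)}.

Let op : Type := (option symbol * move)%type.

(** [KFirst] edits the first kernel tape, where the input is assembled and the output compared;
    [KAll] simulates a step of [MK]. *)
Variant kernel_op :=
  | KNone
  | KFirst of op
  | KAll of ('I_(tm_tapes MK).+1 -> symbol * move).

Record command := Command {
  cmd_next : control + tm_state MK;
  cmd_in : op;
  cmd_adv : op;
  cmd_data : op;
  cmd_kernel : kernel_op }.

Definition is_bit (c : symbol) : option bool :=
  if c is Some (inl b) then Some b else None.

Let skip : op := (None, Stay).
Let right : op := (None, MoveRight).
Let left : op := (None, MoveLeft).
Let put (b : bool) (m : move) : op := (Some (Some (inl b)), m).

(* [Parse o p r] reads the doubly paired input: [o] tells whether the outer
   continuation flag is expected, [p] whether the advice has been reached, and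
   [r] whether the inner flag has been read.  The bits of [x] go to the data
   tape; the advice is decoded onto its tape from right to left, [1 b] denoting
   the bit [b] and [0] a separator.  [Select] and [Skip] then move to the advice
   entry chosen by the certificate, whose remainder is appended to the data.

   An entry is a program for the data head and the kernel tape ([1 b] moves the
   data head, [0 b] pushes the scanned bit xor [b] in front of the kernel
   input), a separator, the parameter in unary and the expected answer of the
   kernelization. *)
Definition act (q : control + tm_state MK) (h0 ha hw : symbol)
    (hk : {ffun 'I_(tm_tapes MK).+1 -> symbol}) : command :=
  match q with
  | inr q =>
      if tm_halt q then Command (inl Compare) skip skip skip KNone else
      let r := tm_trans q hk in Command (inr r.1) skip skip skip (KAll r.2)
  | inl (Parse o p r) =>
      match is_bit h0 with
      | None => Command (inl Select) skip right skip KNone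
      | Some b =>
          match o, p, r, b with
          | true, _, _, true =>
              Command (inl (Parse false p r)) right skip skip KNone
          | true, _, _, false => Command (inl Select) right right skip KNone
          | false, false, false, true =>
              Command (inl (Parse true false true)) right skip skip KNone
          | false, false, false, false =>
              Command (inl (Parse true true false)) right skip skip KNone
          | false, false, true, _ =>
              Command (inl (Parse true false false)) right skip
                (put b MoveRight) KNone
          | false, true, false, true =>
              Command (inl (Parse true true true)) right skip skip KNone
          | false, true, false, false =>
              Command (inl (Parse true true false)) right
                (Some None, MoveLeft) skip KNone
          | false, true, true, _ =>
              Command (inl (Parse true true false)) right
                (put b MoveLeft) skip KNone
          end
      end
  | inl Select =>
      match is_bit h0 with
      | Some true => Command (inl (Skip false)) right skip skip KNone
      | Some false => Command (inl Copy) right skip skip KNone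
      | None => Command (inl Copy) skip skip skip KNone
      end
  | inl (Skip l) =>
      if is_bit ha is Some _ then Command (inl (Skip l)) skip right skip KNone
      else Command (inl (if l then Select else Skip true)) skip right skip KNone
  | inl Copy =>
      if is_bit h0 is Some b then
        Command (inl Copy) right skip (put b MoveRight) KNone
      else Command (inl Rewind) skip skip left KNone
  | inl Rewind =>
      if is_bit hw is Some _ then Command (inl Rewind) skip skip left KNone
      else Command (inl Fetch) skip skip skip KNone
  | inl Fetch =>
      match is_bit ha with
      | Some true => Command (inl Walk) skip right skip KNone
      | Some false => Command (inl Read) skip right skip KNone
      | None => Command (inl (Push false true)) skip right skip KNone
      end
  | inl Walk =>
      if is_bit ha is Some b then
        Command (inl Fetch) skip right (if b then right else left) KNone
      else Command (inl (Push false true)) skip right skip KNone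
  | inl Read =>
      if is_bit ha is Some b then
        Command (inl (Push ((is_bit hw == Some true) (+) b) false))
          skip right skip KNone
      else Command (inl (Push false true)) skip right skip KNone
  | inl (Push b n) =>
      if hk ord0 is None then
        Command (inl (if n then Unary else Fetch)) skip skip skip
          (KFirst (put b Stay))
      else Command (inl (Push b n)) skip skip skip (KFirst left)
  | inl Unary =>
      match is_bit ha with
      | Some true => Command (inl (Push true true)) skip right skip KNone
      | Some false => Command (inr (tm_start MK)) skip right skip KNone
      | None => Command (inr (tm_start MK)) skip skip skip KNone
      end
  | inl Compare =>
      match is_bit ha, is_bit (hk ord0) with
      | Some b, Some b' =>
          if b == b' then Command (inl Compare) skip right skip (KFirst right)
          else Command (inl Done) (put false Stay) skip skip KNone
      | None, None => Command (inl Done) (put true Stay) skip skip KNone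
      | _, _ => Command (inl Done) (put false Stay) skip skip KNone
      end
  | inl Done => Command (inl Done) skip skip skip KNone
  end.

(** Named tapes keep tape indices out of the analysis of the phases; [vembed] transfers the results
    to the actual machine. *)
Record vconfig := VConfig {
  vstate : control + tm_state MK;
  vin : tape (tm_work MK);
  vadv : tape (tm_work MK);
  vdata : tape (tm_work MK);
  vkernel : ktapes }.

Definition kernel_apply (k : ktapes) (o : kernel_op) : ktapes :=
  match o with
  | KNone => k
  | KFirst o => [ffun j => if j == ord0 then tape_op (k j) o else k j]
  | KAll f => [ffun j => tape_move (tape_write (k j) (f j).1) (f j).2]
  end.

Definition vstep (c : vconfig) : vconfig :=
  if vstate c == inl Done then c else
  let r := act (vstate c) (thead (vin c)) (thead (vadv c)) (thead (vdata c))
             [ffun j => thead (vkernel c j)] in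
  VConfig (cmd_next r) (tape_op (vin c) (cmd_in r)) (tape_op (vadv c) (cmd_adv r))
    (tape_op (vdata c) (cmd_data r)) (kernel_apply (vkernel c) (cmd_kernel r)).

Definition vindex : Type := 'I_(3 + (tm_tapes MK).+1).

Definition full_op (h : symbol) (o : op) : symbol * move := (odflt h o.1, o.2).

Definition command_op (r : command) (h : vindex -> symbol) (i : vindex) :
    symbol * move :=
  match split i with
  | inl j => full_op (h i) (nth (cmd_data r) [:: cmd_in r; cmd_adv r] j)
  | inr j =>
      match cmd_kernel r with
      | KNone => full_op (h i) skip
      | KFirst o => full_op (h i) (if j == ord0 then o else skip)
      | KAll f => f j
      end
  end.

Definition verifier : TM :=
  @MkTM (tm_tapes MK).+3 (tm_work MK) (control + tm_state MK)%type
    (inl (Parse true false false)) (pred1 (inl Done))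
    (fun q h =>
       let r := act q (h (lshift _ (inord 0 : 'I_3)))
                  (h (lshift _ (inord 1 : 'I_3))) (h (lshift _ (inord 2 : 'I_3)))
                  [ffun j => h (rshift 3 j)] in
       (cmd_next r, command_op r h)).

Definition vembed (c : vconfig) : config verifier :=
  (vstate c,
   [ffun i : vindex => match split i with
      | inl j => nth (vdata c) [:: vin c; vadv c] j
      | inr j => vkernel c j
      end]).

Lemma tape_op_full (t : tape (tm_work MK)) (o : op) :
  tape_move (tape_write t (full_op (thead t) o).1) (full_op (thead t) o).2 =
  tape_op t o.
Proof. by case: o => -[c|] m //; rewrite /tape_op; case: t. Qed.

Lemma vstep_embed c : @tm_step verifier (vembed c) = vembed (vstep c).
Proof.
rewrite /tm_step /vstep /=; case: ifP => // _.
set r := act _ _ _ _ _; set r' := act _ _ _ _ _.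
have -> : r = r'.
  rewrite /r /r' !ffunE !(unsplitK (inl _)) /= !inordK //=.
  by congr (act _ _ _ _ _); apply/ffunP => j; rewrite !ffunE (unsplitK (inr _)).
congr (_, _); apply/ffunP => i; rewrite !ffunE /command_op !ffunE.
case: (@split 3 (tm_tapes MK).+1 i) => j.
  by rewrite tape_op_full; case: j => -[|[|[|]]].
case: (cmd_kernel r') => [|o|f] /=; rewrite ?tape_op_full ?ffunE //.
  by case: (vkernel c j).
by case: ifP.
Qed.

Lemma vembed_in c : (vembed c).2 ord0 = vin c.
Proof.
by rewrite ffunE; case: (@splitP 3 (tm_tapes MK).+1 ord0) => -[[|j] ltj].
Qed.

Lemma viter_embed m c :
  iter m (@tm_step verifier) (vembed c) = vembed (iter m vstep c).
Proof. by elim: m => //= m ->; rewrite vstep_embed. Qed.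

(** * The phases of the machine and their running times *)

Definition reach (m : nat) (c c' : vconfig) : Prop :=
  exists2 j, j <= m & iter j vstep c = c'.

Lemma reach_refl m c : reach m c c.
Proof. by exists 0. Qed.

Lemma reach_step m c c' : reach m (vstep c) c' -> reach m.+1 c c'.
Proof. by case=> j lej <-; exists j.+1; rewrite ?ltnS // iterSr. Qed.

Lemma reach_trans m m' c c' c'' :
  reach m c c' -> reach m' c' c'' -> reach (m + m') c c''.
Proof.
move=> [j lej <-] [j' lej' <-]; exists (j' + j); last by rewrite iterD.
by rewrite addnC leq_add.
Qed.

Lemma reach_le m m' c c' : m <= m' -> reach m c c' -> reach m' c c'.
Proof. by move=> le [j lej <-]; exists j => //; apply: leq_trans le. Qed.

Notation bits := (bit_cells (tm_work MK)).

(** Result of the [Parse] phase on an arbitrary string: the unread rest, the decoded advice, and the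
    data read so far, last bit first. This and the following functions are total, since the time
    bound has to hold on malformed inputs too. *)
Fixpoint parse (o p r : bool) (s : seq bool) (a : seq symbol) (w : seq bool) :
    seq bool * seq symbol * seq bool :=
  if s is b :: s' then
    match o, p, r, b with
    | true, _, _, true => parse false p r s' a w
    | true, _, _, false => (s', a, w)
    | false, false, false, true => parse true false true s' a w
    | false, false, false, false => parse true true false s' a w
    | false, false, true, _ => parse true false false s' a (b :: w)
    | false, true, false, true => parse true true true s' a w
    | false, true, false, false => parse true true false s' (None :: a) w
    | false, true, true, _ => parse true true false s' (Some (inl b) :: a) w
    end
  else ([::], a, w).

Lemma size_parse o p r s a w :
  let: (s', a', w') := parse o p r s a w in
  size s' + size a' + size w' <= size s + size a + size w.
Proof.
elim: s o p r a w => [|b s IH] o p r a w //=.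
case: o p r b => [] [] [] [] /=; try lia.
all: match goal with |- context [parse ?o ?p ?r ?s ?a ?w] =>
       have := IH o p r a w; case: (parse o p r s a w) => [[s' a'] w'] /=; lia
     end.
Qed.

Lemma parse_reach o p r s a w l k : exists l',
  let: (s', a', w') := parse o p r s a w in
  reach (size s).+1
    (VConfig (inl (Parse o p r)) (tape_at l (bits s)) (Tape [::] None a)
       (Tape (bits w) None [::]) k)
    (VConfig (inl Select) (tape_at l' (bits s')) (tape_at [:: None] a')
       (Tape (bits w') None [::]) k).
Proof.
elim: s o p r a w l => [|b s IH] o p r a w l.
  by exists l; apply: reach_step; apply: reach_refl.
have step o' p' r' a' w' :
  parse o p r (b :: s) a w = parse o' p' r' s a' w' ->
  vstep (VConfig (inl (Parse o p r)) (tape_at l (bits (b :: s)))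
           (Tape [::] None a) (Tape (bits w) None [::]) k) =
  VConfig (inl (Parse o' p' r')) (tape_at (Some (inl b) :: l) (bits s))
    (Tape [::] None a') (Tape (bits w') None [::]) k ->
  exists l', let: (s', a', w') := parse o p r (b :: s) a w in
    reach (size (b :: s)).+1
      (VConfig (inl (Parse o p r)) (tape_at l (bits (b :: s)))
         (Tape [::] None a) (Tape (bits w) None [::]) k)
      (VConfig (inl Select) (tape_at l' (bits s')) (tape_at [:: None] a')
         (Tape (bits w') None [::]) k).
  move=> -> vE; have [l' hl'] := IH o' p' r' a' w' (Some (inl b) :: l).
  exists l'; case: (parse _ _ _ _ _ _) hl' => [[s1 a1] w1] hl'.
  by apply: reach_step; rewrite vE.
case: o step => step; last first.
  by case: p r b step => [] [] [] step;
    eapply step; reflexivity.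
case: b step => step; first by eapply step; reflexivity.
by exists (Some (inl false) :: l); apply: reach_step; apply: reach_refl.
Qed.

Fixpoint skip_segment (a : seq symbol) : seq symbol :=
  if a is c :: a' then
    if is_bit c is Some _ then skip_segment a' else a'
  else [::].

Lemma size_skip_segment a : size (skip_segment a) <= size a.
Proof. by elim: a => //= -[[b|c]|] a IH //=; rewrite leqW. Qed.

Lemma skip_reach (q : bool) a l t0 w k : exists l',
  reach (size a).+1
    (VConfig (inl (Skip q)) t0 (tape_at l a) w k)
    (VConfig (inl (if q then Select else Skip true)) t0
       (tape_at l' (skip_segment a)) w k).
Proof.
elim: a l => [|c a IH] l.
  by exists (None :: l); apply: reach_step; apply: reach_refl.
case: c => [[b|c]|].
- have [l' hl'] := IH (Some (inl b) :: l); exists l'.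
  exact: reach_step.
- exists (Some (inr c) :: l); apply: reach_step; exact: reach_refl.
- exists (None :: l); apply: reach_step; exact: reach_refl.
Qed.

(** An advice entry has two segments, so each leading 1 of the certificate skips two. *)
Fixpoint select (s : seq bool) (a : seq symbol) : seq bool * seq symbol :=
  match s with
  | [::] => ([::], a)
  | false :: s' => (s', a)
  | true :: s' => select s' (skip_segment (skip_segment a))
  end.

Lemma size_select s a :
  size (select s a).1 <= size s /\ size (select s a).2 <= size a.
Proof.
elim: s a => [|[] s IH] a //=.
have [le1 le2] := IH (skip_segment (skip_segment a)); split; first exact: leqW.
by apply: leq_trans le2 _; do 2!apply: leq_trans (size_skip_segment _) _.
Qed.

Lemma select_reach s a l la w k : exists l' la',
  reach ((size s).+1 * ((size a).*2 + 3))
    (VConfig (inl Select) (tape_at l (bits s)) (tape_at la a) w k)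
    (VConfig (inl Copy) (tape_at l' (bits (select s a).1))
       (tape_at la' (select s a).2) w k).
Proof.
elim: s a l la => [|[] s IH] a l la.
- exists l, la; rewrite mul1n addnS; apply: reach_step; exact: reach_refl.
- have [la1 h1] := skip_reach false a la (tape_at (Some (inl true) :: l) (bits s)) w k.
  have [la2 h2] := skip_reach true (skip_segment a) la1
    (tape_at (Some (inl true) :: l) (bits s)) w k.
  have [l' [la' h]] := IH (skip_segment (skip_segment a)) (Some (inl true) :: l) la2.
  exists l', la'.
  have := reach_step (c := VConfig (inl Select) (tape_at l (bits (true :: s)))
    (tape_at la a) w k) (reach_trans h1 (reach_trans h2 h)).
  apply: reach_le => /=.
  have le1 := size_skip_segment a; have le2 := size_skip_segment (skip_segment a).
  have : (size s).+1 * ((size (skip_segment (skip_segment a))).*2 + 3) <=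
         (size s).+1 * ((size a).*2 + 3) by rewrite leq_mul2l; lia.
  rewrite [(size s).+2 * _]mulSn; move: ((size s).+1 * _) ((size s).+1 * _) => u v.
  by move: (size (skip_segment a)) (size a) le1 {le2 IH h1 h2 h} => x y; lia.
- exists (Some (inl false) :: l), la.
  apply: (@reach_le 1); first by rewrite muln_gt0 addnS.
  apply: reach_step; exact: reach_refl.
Qed.

Lemma copy_reach s l ta w k : exists l',
  reach (size s).+1
    (VConfig (inl Copy) (tape_at l (bits s)) ta (Tape (bits w) None [::]) k)
    (VConfig (inl Rewind) (tape_at l' [::]) ta
       (Tape (behead (bits (catrev s w))) (head None (bits (catrev s w)))
          [:: None]) k).
Proof.
elim: s l w => [|b s IH] l w.
  by exists l; apply: reach_step; apply: reach_refl.
have [l' h] := IH (Some (inl b) :: l) (b :: w); exists l'.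
exact: reach_step.
Qed.

Lemma rewind_reach w r t0 ta k :
  reach (size w).+1
    (VConfig (inl Rewind) t0 ta
       (Tape (behead (bits w)) (head None (bits w)) r) k)
    (VConfig (inl Fetch) t0 ta (Tape [::] None (catrev (bits w) r)) k).
Proof.
elim: w r => [|b w IH] r; first by apply: reach_step; apply: reach_refl.
by apply: reach_step; apply: IH.
Qed.

Definition kernel_input (s : seq bool) : ktapes :=
  [ffun j => tape_at [::] (if j == ord0 then bits s else [::])].

Lemma vstep_push b n t0 ta w (k : ktapes) :
  vstep (VConfig (inl (Push b n)) t0 ta w k) =
  if thead (k ord0) is None then
    VConfig (inl (if n then Unary else Fetch)) t0 ta w
      (kernel_apply k (KFirst (put b Stay)))
  else VConfig (inl (Push b n)) t0 ta w (kernel_apply k (KFirst left)).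
Proof. by rewrite /vstep /= !ffunE; case: (thead (k ord0)). Qed.

(** One step to leave the bit written last, if there is one, and one to write on the blank to its
    left. *)
Lemma push_reach b n s t0 ta w :
  reach 2 (VConfig (inl (Push b n)) t0 ta w (kernel_input s))
    (VConfig (inl (if n then Unary else Fetch)) t0 ta w (kernel_input (b :: s))).
Proof.
case: s => [|b' s]; apply: reach_step; rewrite vstep_push ffunE /=.
  suff -> : [ffun j => if j == ord0 then tape_op (kernel_input [::] j) (put b Stay)
                       else kernel_input [::] j] = kernel_input [:: b].
    exact: reach_refl.
  by apply/ffunP => j; rewrite !ffunE; case: (j == ord0).
apply: reach_step; rewrite vstep_push !ffunE /=.
set k := finfun _; suff -> : k = kernel_input [:: b, b' & s] by exact: reach_refl.
by apply/ffunP => j; rewrite !ffunE; case: (j == ord0).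
Qed.

Fixpoint exec (a : seq symbol) (w : tape (tm_work MK)) (s : seq bool) :
    seq symbol * seq bool :=
  match a with
  | Some (inl true) :: Some (inl b) :: a' =>
      exec a' (tape_move w (if b then MoveRight else MoveLeft)) s
  | Some (inl false) :: Some (inl b) :: a' =>
      exec a' w ((is_bit (thead w) == Some true) (+) b :: s)
  | Some (inl _) :: _ :: a' => (a', s)
  | Some (inl _) :: [::] => ([::], s)
  | _ :: a' => (a', s)
  | [::] => ([::], s)
  end.

(** The extra [false] is the separator of [instance_code]; the unary parameter is pushed in front of
    it afterwards. Induction is on the size, because an instruction takes two cells. *)
Lemma exec_reach a w s t0 la : exists la' w',
  reach (2 * size a + 4)
    (VConfig (inl Fetch) t0 (tape_at la a) w (kernel_input s))
    (VConfig (inl Unary) t0 (tape_at la' (exec a w s).1) w'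
       (kernel_input (false :: (exec a w s).2))) /\
  size (exec a w s).1 + size (exec a w s).2 <= size a + size s.
Proof.
have [m] := ubnP (size a); elim: m => // m IH in a w s la *.
case: a => [|[[b|c]|] a].
- exists (None :: la), w; split=> //; apply: (@reach_le 3) => //.
  by apply: reach_step; apply: push_reach.
- case: a => [|c a] lem.
    exists [:: None, Some (inl b) & la], w.
    case: b {lem}; (split; last by rewrite /=; lia);
      apply: (@reach_le 4) => //; do 2!apply: reach_step; exact: push_reach.
  have [c0|[b' c0]] : is_bit c = None \/ exists b', c = Some (inl b').
    by case: c {lem} => [[b'|c]|] /=; [right; exists b'|left|left].
    have -> : exec [:: Some (inl b), c & a] w s = (a, s).
      by case: b c c0 {lem} => [] [[]|].
    exists [:: c, Some (inl b) & la], w; split; last by rewrite /=; lia.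
    apply: (@reach_le 4); first by rewrite /=; lia.
    case: b {lem}; do 2!apply: reach_step; rewrite {1}/vstep /= c0 /=.
      exact: push_reach.
    exact: push_reach.
  rewrite {}c0 in lem *; case: b lem => lem.
    have [|la' [w' [h le]]] := IH a (tape_move w (if b' then MoveRight else MoveLeft))
      s [:: Some (inl b'), Some (inl true) & la]; first exact: ltnW.
    exists la', w'; split; last by apply: leq_trans le _; rewrite /=; lia.
    apply: (@reach_le (2 * size a + 4).+2); first by rewrite /=; lia.
    by do 2!apply: reach_step; case: b' {lem le} h.
  set b1 := (is_bit (thead w) == Some true) (+) b'.
  have [|la' [w' [h le]]] := IH a w (b1 :: s)
      [:: Some (inl b'), Some (inl false) & la]; first exact: ltnW.
  exists la', w'; split; last by apply: leq_trans le _; rewrite /=; lia.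
  apply: (@reach_le (2 + (2 * size a + 4)).+2); first by rewrite /=; lia.
  do 2!apply: reach_step.
  exact: (reach_trans (push_reach b1 false s t0 _ w) h).
- exists (Some (inr c) :: la), w; split; last by rewrite /=; lia.
  apply: (@reach_le 3); first by rewrite /=; lia.
  by apply: reach_step; apply: push_reach.
- exists (None :: la), w; split; last by rewrite /=; lia.
  apply: (@reach_le 3); first by rewrite /=; lia.
  by apply: reach_step; apply: push_reach.
Qed.

Fixpoint unary (a : seq symbol) : nat * seq symbol :=
  match a with
  | Some (inl true) :: a' => ((unary a').1.+1, (unary a').2)
  | Some (inl false) :: a' => (0, a')
  | _ => (0, a)
  end.

Lemma size_unary a : (unary a).1 + size (unary a).2 <= size a.
Proof. by elim: a => //= -[[[]|c]|] a IH //=; rewrite add0n leqnSn. Qed.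

Lemma unary_reach a la w s t0 : exists la',
  reach (3 * size a + 1)
    (VConfig (inl Unary) t0 (tape_at la a) w (kernel_input s))
    (VConfig (inr (tm_start MK)) t0 (tape_at la' (unary a).2) w
       (kernel_input (nseq (unary a).1 true ++ s))).
Proof.
elim: a la s => [|c a IH] la s.
  by exists la; apply: reach_step; apply: reach_refl.
have le1 : 1 <= 3 * size (c :: a) + 1 by rewrite addn1.
case: c le1 => [[[]|c]|] le1; last 3 first.
- exists (Some (inl false) :: la); apply: reach_le le1 _.
  by apply: reach_step; apply: reach_refl.
- exists la; apply: reach_le le1 _.
  by apply: reach_step; apply: reach_refl.
- exists la; apply: reach_le le1 _.
  by apply: reach_step; apply: reach_refl.
have [la' h] := IH (Some (inl true) :: la) (true :: s); exists la'.
have catE j : nseq j.+1 true ++ s = nseq j true ++ true :: s.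
  by elim: j => //= j ->.
apply: (@reach_le (2 + (3 * size a + 1)).+1); first by rewrite /=; lia.
apply: reach_step; rewrite -[unary _]/((unary a).1.+1, (unary a).2) catE.
exact: (reach_trans (push_reach true true s t0 _ w) h).
Qed.

Lemma vstep_run q t0 ta w k :
  vstep (VConfig (inr q) t0 ta w k) =
  if tm_halt q then VConfig (inl Compare) t0 ta w k else
  let c := @tm_step MK (q, k) in VConfig (inr c.1) t0 ta w c.2.
Proof. by rewrite /vstep /tm_step /=; case: (tm_halt q). Qed.

Lemma run_reach m q t0 ta w k :
  tm_halt (iter m (@tm_step MK) (q, k)).1 ->
  reach m.+1 (VConfig (inr q) t0 ta w k)
    (VConfig (inl Compare) t0 ta w (iter m (@tm_step MK) (q, k)).2).
Proof.
elim: m q k => [|m IH] q k hm; apply: reach_step; rewrite vstep_run.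
  by rewrite hm; apply: reach_refl.
case: ifP => hq; first by rewrite iter_tm_halted //; apply: reach_refl.
move: hm; rewrite iterSr; case: (tm_step _) => q' k'; exact: IH.
Qed.

Lemma compare_reach a la t0 w (k : ktapes) : exists ta k',
  reach (size a).+1 (VConfig (inl Compare) t0 (tape_at la a) w k)
    (VConfig (inl Done)
       (tape_write t0 (Some (inl (leading_bits a ==
          leading_bits (thead (k ord0) :: tright (k ord0))))))
       ta w k').
Proof.
have vE : forall a la k,
    vstep (VConfig (inl Compare) t0 (tape_at la a) w k) =
    match is_bit (head None a), is_bit (thead (k ord0)) with
    | Some b, Some b' =>
        if b == b' then
          VConfig (inl Compare) t0 (tape_at (head None a :: la) (behead a)) w
            (kernel_apply k (KFirst right))
        else VConfig (inl Done) (tape_write t0 (Some (inl false))) (tape_at la a) w k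
    | None, None =>
        VConfig (inl Done) (tape_write t0 (Some (inl true))) (tape_at la a) w k
    | _, _ =>
        VConfig (inl Done) (tape_write t0 (Some (inl false))) (tape_at la a) w k
    end.
  move=> {}a {}la {}k; rewrite /vstep /= ffunE.
  by case: (is_bit _) => [b|]; case: (is_bit _) => [b'|] //=; case: (b == b').
elim: a la k => [|c a IH] la k.
  exists (tape_at la [::]), k; apply: reach_step; rewrite vE.
  by case: (thead (k ord0)) => [[b|c]|]; apply: reach_refl.
case: c => [[b|c]|]; last 2 first.
- exists (tape_at la (Some (inr c) :: a)), k; apply: reach_step; rewrite vE /=.
  by case: (thead (k ord0)) => [[b|c']|]; apply: reach_refl.
- exists (tape_at la (None :: a)), k; apply: reach_step; rewrite vE /=.
  by case: (thead (k ord0)) => [[b|c']|]; apply: reach_refl.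
have [ta [k' h]] := IH (Some (inl b) :: la) (kernel_apply k (KFirst right)).
case kE : (k ord0) => [l [[b'|c]|] r]; last 2 first.
- exists (tape_at la (Some (inl b) :: a)), k; apply: reach_step; rewrite vE kE /=.
  exact: reach_refl.
- exists (tape_at la (Some (inl b) :: a)), k; apply: reach_step; rewrite vE kE /=.
  exact: reach_refl.
rewrite /= eqseq_cons; have [eqb|neq] := eqVneq b b'; last first.
  exists (tape_at la (Some (inl b) :: a)), k; apply: reach_step; rewrite vE kE /=.
  rewrite (negbTE neq); exact: reach_refl.
exists ta, k'; apply: reach_step; rewrite vE kE /= eqb eqxx -eqb.
have rE : leading_bits (head None r :: behead r) = leading_bits r by case: r {kE}.
have kE' : kernel_apply k (KFirst right) ord0 =
    Tape (Some (inl b') :: l) (head None r) (behead r) by rewrite ffunE kE.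
by rewrite kE' in h; rewrite -rE.
Qed.

(** The tape as [Rewind] leaves it: head on the blank before the data, and a trailing blank that was
    scanned at the end of [Copy]. *)
Definition data_tape (d : seq bool) : tape (tm_work MK) :=
  Tape [::] None (rcons (bits d) None).

Variable K : instance -> instance.

(** The function decided by the machine, with the run of [MK] replaced by [K]. *)
Definition verdict (s : seq bool) : bool :=
  let: (s1, a1, w) := parse true false false s [::] [::] in
  let: (y, a2) := select s1 a1 in
  let: (a3, d) := exec a2 (data_tape (catrev w y)) [::] in
  let: (j, a4) := unary a3 in
  leading_bits a4 == instance_code (K (d, j)).

Variable pK : {poly nat}.
Hypothesis MKP : forall i,
  tm_computes_in MK (instance_code i) (pK.[size (instance_code i)])%R
    (instance_code (K i)).

(** One summand per phase, in order: parsing, selection, copying, rewinding, program, unary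
    parameter, kernelization, comparison. *)
Definition verifier_time (N : nat) : nat :=
  N.+1 + (N.+1 * (N.*2 + 3) + (N.+1 + (N.+1 + (2 * N + 4 + (3 * N + 1 +
    (((pK.[N.+1])%R : nat).+1 + N.+1)))))).

Lemma verifier_computes s :
  tm_computes_in verifier s (verifier_time (size s)) [:: verdict s].
Proof.
have initE : tm_init verifier s =
    vembed (VConfig (inl (Parse true false false)) (tape_at [::] (bits s))
      (Tape [::] None [::]) (Tape (bits [::]) None [::]) (kernel_input [::])).
  congr (_, _); apply/ffunP => i; rewrite !ffunE.
  have -> : (i == ord0) = (i == 0 :> nat) by [].
  case: (@splitP 3 (tm_tapes MK).+1 i) => j ->; last by rewrite !ffunE; case: ifP.
  by case: j => -[|[|[|]]].
suff [t0 [ta [w [k h]]]] : exists t0 ta w k, reach (verifier_time (size s))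
    (VConfig (inl (Parse true false false)) (tape_at [::] (bits s))
       (Tape [::] None [::]) (Tape (bits [::]) None [::]) (kernel_input [::]))
    (VConfig (inl Done) (Tape t0 (Some (inl (verdict s))) [::]) ta w k).
  case: h => j lej hj; apply: tm_computes_in_le lej _.
  rewrite /tm_computes_in initE viter_embed hj; split; first exact: eqxx.
  by rewrite /tm_output vembed_in.
rewrite /verdict; have := size_parse true false false s [::] [::].
have [l1] := parse_reach true false false s [::] [::] [::] (kernel_input [::]).
case: (parse _ _ _ _ _ _) => [[s1 a1] w1] h1; rewrite /= !addn0 => le1.
have [l2 [la2]] := select_reach s1 a1 l1 [:: None] (Tape (bits w1) None [::])
  (kernel_input [::]).
have := size_select s1 a1; case: (select s1 a1) => [y a2] /= [ley lea] h2.
have [l3 h3] := copy_reach y l2 (tape_at la2 a2) w1 (kernel_input [::]).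
have h4 := rewind_reach (catrev y w1) [:: None] (tape_at l3 [::])
  (tape_at la2 a2) (kernel_input [::]).
have dE : catrev (bits (catrev y w1)) [:: None] = rcons (bits (catrev w1 y)) None.
  by rewrite -cats1 !catrevE /bit_cells -map_rev rev_cat revK.
rewrite dE -/(data_tape _) in h4.
have [la5 [w5 [h5 le5]]] := exec_reach a2 (data_tape (catrev w1 y)) [::]
  (tape_at l3 [::]) la2.
case: (exec _ _ _) h5 le5 => [a3 d] /= h5 le5.
have [la6 h6] := unary_reach a3 la5 w5 (false :: d) (tape_at l3 [::]).
have := size_unary a3; case: (unary a3) h6 => [j a4] /= h6 le6.
have kE : tm_init MK (instance_code (d, j)) =
    (tm_start MK, kernel_input (instance_code (d, j))).
  by congr (_, _); apply/ffunP => i; rewrite !ffunE; case: (i == ord0).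
have [] := MKP (d, j); rewrite kE => halted out.
have h7 := run_reach (tape_at l3 [::]) (tape_at la6 a4) w5 halted.
have [ta [k' h8]] := compare_reach a4 la6 (tape_at l3 [::]) w5
  (iter (pK.[size (instance_code (d, j))])%R (@tm_step MK)
     (tm_start MK, kernel_input (instance_code (d, j)))).2.
rewrite -/(tm_output _) out in h8.
exists l3, ta, w5, k'.
have := reach_trans h1 (reach_trans h2 (reach_trans h3 (reach_trans h4
  (reach_trans h5 (reach_trans h6 (reach_trans h7 h8)))))).
apply: reach_le; rewrite /verifier_time catrevE size_cat size_rev.
have les : size s1 <= size s by apply: leq_trans le1; rewrite -addnA leq_addr.
have lea1 : size a1 <= size s by apply: leq_trans le1; rewrite addnAC leq_addl.
have lew : size y + size w1 <= size s.
  by apply: leq_trans le1; rewrite leq_add2r (leq_trans ley) // leq_addr.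
have lea2 := leq_trans lea lea1; rewrite addn0 in le5.
have le5' := leq_trans le5 lea2.
have lea3 : size a3 <= size s by apply: leq_trans le5'; rewrite leq_addr.
have lea4 : size a4 <= size s.
  by apply: leq_trans lea3; apply: leq_trans le6; rewrite leq_addl.
(* Each bit of the kernel input is paid for by a cell of the advice, except the separator. *)
have lecode : size (instance_code (d, j)) <= (size s).+1.
  rewrite size_cat size_nseq /= addnS ltnS; apply: leq_trans le5'.
  by rewrite leq_add2r; apply: leq_trans le6; rewrite leq_addr.
have lep := horner_nat_mono pK lecode.
rewrite !leq_add ?leq_mul ?ltnS ?leq_add2r ?leq_double ?leq_mul2l ?leqnn //=.
exact: leq_trans ley les.
Qed.

Lemma polytime_verdict : polytime id (fun b : bool => [:: b]) verdict.
Proof.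
have : poly_bounded verifier_time by rewrite /verifier_time; poly_bound.
case=> p leT; exists verifier, p => s.
exact: tm_computes_in_le (leT _) (verifier_computes s).
Qed.

End Verifier.

(** * The verdict on well-formed advice *)

(* Entries of the composed adjacency matrix as the machine sees them: a
   constant, or the data bit at a given position, possibly negated. *)
Definition pointer : Type := (bool + nat * bool)%type.

Definition eval_pointer (d : seq bool) (q : pointer) : bool :=
  match q with inl c => c | inr (p, c) => nth false d p (+) c end.

(* On the data tape position [0] is blank, so data bit [p] is [p.+1] moves away
   and constants are read off in place. *)
Definition pointer_code (q : pointer) : seq bool :=
  match q with
  | inl c => [:: false; c]
  | inr (p, c) =>
      flatten (nseq p.+1 [:: true; true]) ++ [:: false; c] ++
      flatten (nseq p.+1 [:: true; false])
  end.

(** Matrix entries and parameter of a composed instance, and the kernel expected for it. *)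
Definition entry : Type := (seq pointer * nat * instance)%type.

(** The program is reversed because every [Push] prepends a bit. *)
Definition entry_code (e : entry) : seq (option bool) :=
  [seq Some b | b <- flatten [seq pointer_code q | q <- rev e.1.1]] ++ None ::
  [seq Some b | b <- nseq e.1.2 true ++ false :: instance_code e.2] ++ [:: None].

Definition option_code (c : option bool) : seq bool :=
  if c is Some b then [:: true; b] else [:: false].

Definition advice_code (es : seq entry) : seq bool :=
  flatten [seq option_code c | c <- rev (flatten [seq entry_code e | e <- es])].

Lemma instance_code_inj : injective instance_code.
Proof.
move=> [x k] [x' k'] /=; rewrite /instance_code /=.
by elim: k k' => [|k IH] [|k'] //= [] => [->|/IH [-> ->]].
Qed.

Section Verdict.
Variables (MK : TM) (K : instance -> instance).
Notation symbol := (cell (tm_work MK)).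

Definition symbols (s : seq (option bool)) : seq symbol :=
  [seq omap inl c | c <- s].

Definition accepts (d : seq bool) (e : entry) : bool :=
  e.2 == K ([seq eval_pointer d q | q <- e.1.1], e.1.2).

Lemma parse_input x c y (a : seq symbol) w :
  parse true false false (pair_code (pair_code x c) y) a w =
  parse true true false (pair_code c y) a (catrev x w).
Proof. by elim: x w => //= b x IH w; rewrite -IH. Qed.

Lemma parse_advice s y (a : seq symbol) w :
  parse true true false (pair_code (flatten [seq option_code c | c <- s]) y) a w =
  (y, catrev (symbols s) a, w).
Proof. by elim: s a => //= -[b|] s IH a; rewrite -IH. Qed.

Lemma skip_segment_code s r :
  skip_segment (symbols ([seq Some b | b <- s] ++ None :: r)) = symbols r.
Proof. by elim: s. Qed.

Lemma skip_entry_code e es :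
  skip_segment (skip_segment (symbols (entry_code e ++ es))) = symbols es.
Proof.
by rewrite /entry_code -catA cat_cons skip_segment_code -catA skip_segment_code.
Qed.

Notation entries es := (symbols (flatten [seq entry_code e | e <- es])).

Lemma select_entry m y es :
  select (nseq m true ++ false :: y) (entries es) = (y, entries (drop m es)).
Proof.
elim: m es => [|m IH] [|e es] //=; last by rewrite skip_entry_code IH.
exact: (IH [::]).
Qed.

(** Whatever the certificate, selection stops at an entry boundary, so no certificate can run the
    advice from the middle of an entry. *)
Lemma select_some_entry y es :
  exists m y', select y (entries es) = (y', entries (drop m es)).
Proof.
elim: y es => [|[] y IH] es.
- by exists 0, [::]; rewrite drop0.
- case: es => [|e es] /=.
    by have [m [y' h]] := IH [::]; exists m, y'.
  by rewrite skip_entry_code; have [m [y' ->]] := IH es; exists m.+1, y'.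
- by exists 0, y; rewrite drop0.
Qed.

Lemma tget_iter_move (A : finType) (t : tape A) v m d :
  tget (iter m (fun t => tape_move t v) t) d = tget t (d + shift v *+ m)%R.
Proof.
elim: m d => [|m IH] d; first by rewrite GRing.mulr0n GRing.addr0.
by rewrite iterS tget_move IH GRing.mulrS GRing.addrA.
Qed.

Lemma exec_walk (v : bool) m r (w : tape (tm_work MK)) s :
  exec (symbols ([seq Some b | b <- flatten (nseq m [:: true; v])] ++ r)) w s =
  exec (symbols r)
    (iter m (fun t => tape_move t (if v then MoveRight else MoveLeft)) w) s.
Proof. by elim: m w => //= m IH w; rewrite IH -iterSr. Qed.

(** Tapes are compared through [tget], because walking to a bit and back may pad the lists with
    blanks. *)
Lemma exec_pointer q r d (w : tape (tm_work MK)) s :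
  tget w =1 tget (data_tape MK d) ->
  exists2 w', tget w' =1 tget (data_tape MK d) &
    exec (symbols ([seq Some b | b <- pointer_code q] ++ r)) w s =
    exec (symbols r) w' (eval_pointer d q :: s).
Proof.
move=> wE; case: q => [c|[p c]].
  by exists w => //=; rewrite -[thead w]/(tget w 0) wE.
rewrite /pointer_code map_cat -catA exec_walk.
set w1 := iter _ _ _.
have w1T z : tget w1 z = tget (data_tape MK d) (z + shift MoveRight *+ p.+1)%R.
  by rewrite tget_iter_move wE.
have w1E : thead w1 = nth None (rcons (bit_cells _ d) None) p.
  by rewrite -[thead w1]/(tget w1 0) w1T GRing.add0r natz.
clearbody w1; exists (iter p.+1 (fun t => tape_move t MoveLeft) w1).
  move=> z; rewrite !tget_iter_move w1T; congr (tget _ _).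
  by rewrite -GRing.addrA -GRing.mulrnDl GRing.addNr GRing.mul0rn GRing.addr0.
rewrite -(exec_walk false) cat_cons /= w1E; congr (exec _ _ (_ (+) _ :: _)).
(* Beyond the data the head scans a blank, which counts as 0, in agreement with the default of
   [nth false]. *)
rewrite nth_rcons size_map; case: ltnP => ltp; first by rewrite (nth_map false).
by rewrite if_same nth_default.
Qed.

Lemma exec_program qs r d (w : tape (tm_work MK)) s :
  tget w =1 tget (data_tape MK d) ->
  exec (symbols ([seq Some b | b <- flatten [seq pointer_code q | q <- qs]] ++
                 None :: r)) w s =
  (symbols r, catrev [seq eval_pointer d q | q <- qs] s).
Proof.
elim: qs w s => [|q qs IH] w s wE //=.
rewrite map_cat -catA.
have [w' w'E ->] := exec_pointer q
  ([seq Some b | b <- flatten [seq pointer_code q | q <- qs]] ++ None :: r) s wE.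
exact: IH.
Qed.

Lemma unary_code k s r :
  unary (symbols ([seq Some b | b <- nseq k true ++ false :: s] ++ r)) =
  (k, symbols ([seq Some b | b <- s] ++ r)).
Proof. by elim: k => //= k ->. Qed.

Lemma leading_bits_code s r :
  leading_bits (symbols ([seq Some b | b <- s] ++ None :: r)) = s.
Proof. by elim: s => //= b s ->. Qed.

Lemma verdictE x es y :
  verdict MK K (pair_code (pair_code x (advice_code es)) y) =
  let: (y', a) := select y (entries es) in
  let: (a', d) := exec a (data_tape MK (x ++ y')) [::] in
  let: (j, a'') := unary a' in
  leading_bits a'' == instance_code (K (d, j)).
Proof.
rewrite /verdict parse_input parse_advice !catrevE !cats0 /symbols map_rev revK.
by case: (select _ _) => y' a; rewrite catrevE revK.
Qed.

Lemma accepts_entry d e r :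
  (let: (a', d) := exec (symbols (entry_code e ++ r)) (data_tape MK d) [::] in
   let: (j, a'') := unary a' in
   leading_bits a'' == instance_code (K (d, j))) = accepts d e.
Proof.
case: e => [[qs k] i]; rewrite /entry_code -catA cat_cons /=.
rewrite (@exec_program _ _ d) // -catA unary_code leading_bits_code.
by rewrite (inj_eq instance_code_inj) map_rev catrevE revK cats0.
Qed.

Lemma verdict_complete x es y e : e \in es -> accepts (x ++ y) e ->
  verdict MK K (pair_code (pair_code x (advice_code es))
                  (nseq (index e es) true ++ false :: y)).
Proof.
move=> ees acc; rewrite verdictE select_entry (drop_index ees) /=.
by rewrite accepts_entry.
Qed.

Lemma verdict_sound x es y :
  verdict MK K (pair_code (pair_code x (advice_code es)) y) ->
  exists e y', e \in es /\ accepts (x ++ y') e.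
Proof.
rewrite verdictE; have [m [y' ->]] := select_some_entry y es.
(* Past the last entry the expected answer is the empty string, which is no instance code. *)
case dE : (drop m es) => [|e es'] /=.
  by rewrite /instance_code; case: (K _) => s [|k].
rewrite accepts_entry => acc; exists e, y'; split=> //.
by apply: (@mem_drop m); rewrite dE mem_head.
Qed.
End Verdict.

(** * Advice from a kernelization *)

Lemma size_flatten_le (A : Type) (ss : seq (seq A)) m :
  all (fun s => size s <= m) ss -> size (flatten ss) <= size ss * m.
Proof.
by elim: ss => //= s ss IH /andP [les /IH le]; rewrite size_cat mulSn leq_add.
Qed.

Lemma size_flatten_map_le (S : eqType) (A : Type) (f : S -> seq A) (s : seq S) m :
  (forall x, x \in s -> size (f x) <= m) ->
  size (flatten [seq f x | x <- s]) <= size s * m.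
Proof.
move=> le; rewrite -(size_map f) size_flatten_le // all_map.
by apply/allP => x /le.
Qed.

Lemma size_flatten_nseq (A : Type) m (s : seq A) :
  size (flatten (nseq m s)) = m * size s.
Proof. by elim: m => //= m IH; rewrite size_cat IH mulSn. Qed.

Lemma size_pointer_code q m :
  (if q is inr (p, _) then p < m else true) -> size (pointer_code q) <= m * 4 + 2.
Proof.
case: q => [c|[p c]] lep; first by rewrite leq_addl.
by rewrite /pointer_code !size_cat !size_flatten_nseq /=; lia.
Qed.

Lemma size_advice_code es m :
  (forall e, e \in es -> size (entry_code e) <= m) ->
  size (advice_code es) <= size es * m * 2.
Proof.
move=> le; apply: (@leq_trans (size (flatten [seq entry_code e | e <- es]) * 2)).
  rewrite -(size_rev (flatten _)); apply: size_flatten_map_le.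
  by move=> [b|] _.
by rewrite leq_mul2r size_flatten_map_le.
Qed.

(* The input under test has index [i0] and is read from the beginning of the
   data; all other inputs are read from the certificate. *)
Definition data_pos (n t : nat) (i0 i : 'I_t) (j : 'I_n) : nat :=
  if i == i0 then j : nat else n + (i * n + j).

Lemma data_pos_lt n t (i0 i : 'I_t) (j : 'I_n) : data_pos i0 i j < (n + t * n).+1.
Proof.
rewrite /data_pos; case: ifP => _; first by rewrite ltnS ltnW // ltn_addr.
rewrite ltnS leq_add2l ltnW //; apply: (@leq_trans (i.+1 * n)).
  by rewrite mulSn addnC ltn_add2r.
by rewrite leq_mul2r ltn_ord orbT.
Qed.

Definition pointer_of (n t : nat) (i0 : 'I_t) (q : query n t) : pointer :=
  match q with inl c => inl c | inr (i, j, c) => inr (data_pos i0 i j, c) end.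

Lemma eval_pointer_of n t (i0 : 'I_t) (f : 'I_t -> n.-tuple bool) d :
  (forall i j, nth false d (data_pos i0 i j) = tnth (f i) j) ->
  forall q, eval_pointer d (pointer_of i0 q) = eval_query f q.
Proof. by move=> dE [c|[[i j] c]] //=; rewrite dE. Qed.

Definition other_inputs n t (f : 'I_t -> n.-tuple bool) : seq bool :=
  flatten [seq tval (f i) | i <- enum 'I_t].

Lemma size_other_inputs n t (f : 'I_t -> n.-tuple bool) :
  size (other_inputs f) = t * n.
Proof.
rewrite size_flatten /shape -map_comp (eq_map (g := fun=> n)).
  by rewrite sumnE big_map big_enum sum_nat_const card_ord.
by move=> i /=; rewrite size_tuple.
Qed.

Lemma nth_other_inputs n t (f : 'I_t -> n.-tuple bool) (i : 'I_t) (j : 'I_n) :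
  nth false (other_inputs f) (i * n + j) = tnth (f i) j.
Proof.
rewrite /other_inputs; case: t f i => [|t] f i; first by case: i.
have H (s : seq 'I_t.+1) m : m < size s ->
    nth false (flatten [seq tval (f i) | i <- s]) (m * n + j) =
    tnth (f (nth ord0 s m)) j.
  elim: s m => //= k s IH [|m] ltm; rewrite nth_cat size_tuple.
    by rewrite ltn_ord -tnth_nth.
  by rewrite mulSn -addnA ltnNge leq_addr /= addKn IH.
by rewrite H ?size_enum_ord // nth_ord_enum.
Qed.

Section Advice.
Variables (L : language) (MK : TM) (K : instance -> instance).
Hypothesis K_correct : forall i, IdentifyingCode i <-> IdentifyingCode (K i).
Variables (n t N k P : nat) (Q : 'I_N -> 'I_N -> query n t).
Hypothesis t_large : P.+1.*2 <= t.

Let inst (f : 'I_t -> n.-tuple bool) : instance :=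
  (graph_code (fun i j => eval_query f (Q i j)), k).

Hypothesis instP : forall f, IdentifyingCode (inst f) <-> exists i, L (f i).
Hypothesis K_small : forall f, size (K (inst f)).1 + (K (inst f)).2 <= P.

Let row (i0 : 'I_t) : seq pointer :=
  [seq pointer_of i0 (Q i j) | i <- enum 'I_N, j <- enum 'I_N].

Lemma advice_row i0 f d :
  (forall i j, nth false d (data_pos i0 i j) = tnth (f i) j) ->
  ([seq eval_pointer d q | q <- row i0], k) = inst f.
Proof.
move=> dE; congr (_, _); rewrite map_allpairs; congr flatten.
by apply: eq_map => i; apply: eq_map => j; apply: eval_pointer_of.
Qed.

(** Kernels of size at most [P] have codes of at most [P.+1] bits; padding with [None] places them
    in a finite type. *)
Definition answer_code (i : instance) : {ffun 'I_P.+1 -> option bool} :=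
  [ffun m : 'I_P.+1 => onth (instance_code i) m].

Lemma answer_code_inj i i' : size i.1 + i.2 <= P -> size i'.1 + i'.2 <= P ->
  answer_code i = answer_code i' -> i = i'.
Proof.
have szE j : size (instance_code j) = (size j.1 + j.2).+1.
  by rewrite size_cat size_nseq addnS addnC.
move=> lei lei' /ffunP eqc; apply/instance_code_inj/eq_from_onth => m.
have [ltm|lem] := ltnP m P.+1; first by have := eqc (Ordinal ltm); rewrite !ffunE.
by rewrite !onth_default // szE; apply: leq_ltn_trans lem.
Qed.

(** A non-member is certified by the rest of a covering tuple of non-members. Conversely, an
    accepted composition contains [x] and shares its kernel with a tuple of non-members, so it is a
    no-instance. *)
Lemma advice_exists : exists es : seq entry,
  [/\ size es <= n.+1,
      forall e, e \in es -> size (entry_code e) <=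
        N * N * ((n + t * n).+1 * 4 + 2) + k + P + 4,
      forall x, size x = n -> ~ L x ->
        exists y, size y <= n.+2 + t * n /\
          verdict MK K (pair_code (pair_code x (advice_code es)) y)
    & forall x y, size x = n ->
        verdict MK K (pair_code (pair_code x (advice_code es)) y) -> ~ L x].
Proof.
pose no : {set n.-tuple bool} := [set x : n.-tuple bool | ~~ `[< L x >]].
pose Phi (f : {ffun 'I_t -> n.-tuple bool}) := answer_code (K (inst f)).
have t0 : 0 < t by apply: leq_trans t_large; rewrite -addnn.
(* There are [3 ^ P.+1] codes, at most [4 ^ P.+1 = 2 ^ P.+1.*2]. *)
have cardY : #|{ffun 'I_P.+1 -> option bool}| <= 2 ^ t.
  rewrite card_ffun card_option card_bool card_ord.
  apply: (@leq_trans (4 ^ P.+1)); first by rewrite leq_exp2r.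
  by rewrite -[4]/(2 ^ 2) -expnM leq_exp2l // mul2n.
have cardno : #|no| < 2 ^ n.+1.
  apply: (@leq_ltn_trans (2 ^ n)); last by rewrite ltn_exp2l.
  by apply: leq_trans (max_card _) _; rewrite card_tuple card_bool.
have [ps [szps psP cover]] := distillation Phi t0 cardY cardno.
(* A code is decoded through some preimage under [Phi]; by injectivity of [answer_code] on small
   kernels its choice is immaterial. *)
pose answer (y : {ffun 'I_P.+1 -> option bool}) : instance :=
  if [pick f : {ffun 'I_t -> n.-tuple bool} |
        [forall i, f i \in no] && (Phi f == y)] is Some f
  then K (inst f) else ([::], 0).
have answerP (f : {ffun 'I_t -> n.-tuple bool}) :
    (forall i, f i \in no) -> answer (Phi f) = K (inst f).
  move=> fno; rewrite /answer; case: pickP => [f' /andP [_ /eqP eqP]|/(_ f)].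
    exact: answer_code_inj (K_small _) (K_small _) eqP.
  by rewrite eqxx andbT; move/forallP: fno => ->.
pose entry_of (e : 'I_t * {ffun 'I_P.+1 -> option bool}) : entry :=
  (row e.1, k, answer e.2).
exists [seq entry_of e | e <- ps]; split.
- by rewrite size_map.
- move=> _ /mapP [e eps ->]; have [f fno eE] := psP e eps.
  rewrite /entry_of -eE answerP //.
  have ler : size (flatten [seq pointer_code q | q <- rev (row e.1)]) <=
      N * N * ((n + t * n).+1 * 4 + 2).
    apply: leq_trans (size_flatten_map_le (m := (n + t * n).+1 * 4 + 2) _) _.
      move=> q; rewrite mem_rev => /allpairsP [[i j] [_ _ ->]] /=.
      apply: size_pointer_code; case: (Q i j) => [//|[[i' j'] c]] /=.
      exact: data_pos_lt.
    by rewrite size_rev size_allpairs !size_enum_ord.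
  rewrite /entry_code size_cat /= size_cat !size_map size_cat /= size_cat.
  rewrite !size_nseq /=; move: ler (K_small f).
  move: (size (flatten _)) (N * N * _) => u v.
  by move: (size (K _).1) (K _).2 => p q; lia.
- move=> x xn nLx; pose x' := Tuple (introT eqP xn).
  have xno : x' \in no by rewrite inE; apply/asboolPn.
  have [e [f [eps fno fe Pf]]] := cover x' xno.
  (* The index of the entry in unary, a separator, and all inputs of the tuple; the block at
     position [e.1] is never read, since [x] stands in for it. *)
  exists (nseq (index (entry_of e) [seq entry_of e | e <- ps]) true
     ++ false :: other_inputs f); split.
    rewrite size_cat size_nseq /= size_other_inputs addnS -!addSn leq_add2r.
    by apply: leq_trans (index_size _ _) _; rewrite size_map.
  apply: verdict_complete; first by apply/mapP; exists e.
  rewrite /accepts /= (@advice_row _ f); first by rewrite -Pf answerP.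
  move=> i j; rewrite /data_pos nth_cat xn; case: eqP => [->|_].
    by rewrite ltn_ord fe (tnth_nth false).
  by rewrite ltnNge leq_addr /= addKn nth_other_inputs.
move=> x y xn /verdict_sound [_ [y' [/mapP [e eps ->]]]].
rewrite /accepts /=; have [f fno eE] := psP e eps.
(* Any certificate determines a full tuple, missing bits being read as 0, and its component at [e.1]
   is [x]. *)
pose f' (i : 'I_t) : n.-tuple bool :=
  [tuple nth false (x ++ y') (data_pos e.1 i j) | j < n].
rewrite (@advice_row _ f') => [/eqP acc Lx|i j]; last by rewrite tnth_mktuple.
have : exists i, L (f i).
  apply/instP/K_correct; rewrite -(answerP _ fno) eE acc.
  apply: (proj1 (K_correct _)); apply/instP.
  exists e.1; rewrite (_ : tval (f' e.1) = x) //.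
  apply: (@eq_from_nth _ false) => [|j]; rewrite size_tuple ?xn // => ltj.
  rewrite -[j]/(nat_of_ord (Ordinal ltj)) -tnth_nth tnth_mktuple /data_pos eqxx.
  by rewrite nth_cat xn ltj.
by case=> i Lfi; have := fno i; rewrite inE => /asboolPn.
Qed.
End Advice.

(** * Choice of the parameters and conclusion *)

Theorem theorem2 :
  ~ class_subset class_NP class_coNP_poly ->
  ~ has_polynomial_kernel IdentifyingCode.
Proof.
move=> nsub [K [pk [[MK [pK MKP]] K_correct K_small]]]; apply: nsub => L LNP.
have [q [pq comp]] := NP_or_composition LNP.
(* The tuple length must exceed the kernel size, which depends on the parameter and hence on the
   logarithm of the tuple length. With [b = u.*2] and [q n <= u] the parameter is at most
   [5 * u + 4], and the bound by [C * 2 ^ u] breaks the circle. *)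
have [C leC] : exists C, forall u, u + ((pk.[5 * u + 4])%R : nat).+1.*2 <= C * 2 ^ u.
  have [p lep] : poly_bounded (fun u => u + ((pk.[5 * u + 4])%R : nat).+1.*2).
    by poly_bound.
  have [C leC] := horner_le_exp2 p; exists C => u.
  exact: leq_trans (lep u) (leC u).
(* Adding [C] ensures [C <= 2 ^ u n], so that [C * 2 ^ u n] is at most [2 ^ (u n).*2] and addresses
   of [(u n).*2.+2] bits suffice. *)
pose u n := q n + C.
pose P n : nat := (pk.[5 * u n + 4])%R.
pose t n := (P n).+1.*2.
pose N n := (q n).*2 + t n + 4 * (u n).*2.+3.
pose a_len n := n.+1 *
  (N n * N n * ((n + t n * n).+1 * 4 + 2) + (5 * u n + 4) + P n + 4) * 2.
pose y_len n := n.+2 + t n * n.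
have pu : poly_bounded u by rewrite /u; poly_bound.
have pP : poly_bounded P by rewrite /P; poly_bound.
have pt : poly_bounded t by rewrite /t; poly_bound.
have pN : poly_bounded N by rewrite /N; poly_bound.
have [pa lea] : poly_bounded a_len by rewrite /a_len; poly_bound.
have [py ley] : poly_bounded y_len by rewrite /y_len; poly_bound.
have advice n : exists a,
    [/\ size a <= a_len n,
        forall x, size x = n -> ~ L x -> exists y,
          size y <= y_len n /\ verdict MK K (pair_code (pair_code x a) y)
      & forall x y, size x = n ->
          verdict MK K (pair_code (pair_code x a) y) -> ~ L x].
  have le_exp : q n + t n <= 2 ^ (u n).*2.+2.
    apply: (@leq_trans (C * 2 ^ u n)).
      by apply: leq_trans (leC (u n)); rewrite leq_add2r leq_addr.
    apply: (@leq_trans (2 ^ u n * 2 ^ u n)); last first.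
      by rewrite -expnD addnn leq_exp2l // leqW // leqnSn.
    rewrite leq_mul2r; apply/orP; right.
    apply: ltnW; apply: leq_trans (ltn_expl C (ltnSn 1)) _.
    by rewrite leq_exp2l // leq_addl.
  have [N' [k [Q [leN lek instP]]]] := comp n (t n) (u n).*2 le_exp.
  have {}lek : k <= 5 * u n + 4 by apply: leq_trans lek _; rewrite /u; lia.
  have Ksm (f : 'I_(t n) -> n.-tuple bool) :
      let i := (graph_code (fun i j => eval_query f (Q i j)), k) in
      size (K i).1 + (K i).2 <= P n.
    by apply: leq_trans (K_small _) _; apply: horner_nat_mono.
  have [es [szes szcode complete sound]] :=
    advice_exists MK K_correct (leqnn _) instP Ksm.
  exists (advice_code es); split=> //.
  apply: leq_trans (size_advice_code szcode) _.
  rewrite leq_mul2r leq_mul //= !leq_add ?leq_mul //.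
have {advice} [a aP] := choice advice.
(* The complement of an NP language: an accepted certificate refutes membership of [x] in [L]. *)
exists (fun w => ~ exists y, size y <= (py.[size w])%R /\ verdict MK K (pair_code w y)).
exists a, pa; split=> [|n|x].
- exists (fun s => verdict MK K s), py; split.
    exists (verdict MK K); split; first exact: polytime_verdict MKP.
    by [].
  by move=> w; split=> [/contrapT|acc /(_ acc)].
- by have [le _ _] := aP n; apply: leq_trans le (lea n).
have [_ complete sound] := aP (size x); split=> [Lx [y [_ acc]]|no].
  exact: (sound x y) acc Lx.
apply: contrapT => nLx; apply: no.
have [y [le acc]] := complete x erefl nLx; exists y; split=> //.
apply: leq_trans le (leq_trans (ley _) _); apply: horner_nat_mono.
by rewrite size_pair_code; lia.
Qed.
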